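(* Let $f\colon\mathbb{R}^n\to\mathbb{R}^n$ be a definable mapping that is a local homeomorphism and such that the set $$K_\infty(f):=\{y\in\mathbb{R}^n : \exists\, (x_k)_k\subset\mathbb{R}^n \text{ with } \|x_k\|\to\infty \text{ such that } f(x_k)\to y \text{ and } \|x_k\|\,\nu_f(x_k)\to0\}$$ is empty. Then $f$ is a global homeomorphism (i.e. a homeomorphism of $\mathbb{R}^n$ onto $\mathbb{R}^n$).
   Context: Fix an o-minimal structure on $(\mathbb{R},+,\cdot)$, i.e. a sequence $(\mathcal{D}_n)_{n\in\mathbb{N}}$ such that: (a) $\mathcal{D}_n$ is a Boolean algebra of subsets of $\mathbb{R}^n$; (b) $X\in\mathcal{D}_m$, $Y\in\mathcal{D}_n$ imply $X\times Y\in\mathcal{D}_{m+n}$; (c) if $X\in\mathcal{D}_{n+1}$ then $\pi(X)\in\mathcal{D}_n$, where $\pi\colon\mathbb{R}^{n+1}\to\mathbb{R}^n$ is the projection on the first $n$ coordinates; (d) $\mathcal{D}_n$ contains all algebraic subsets of $\mathbb{R}^n$; (e) each set in $\mathcal{D}_1$ is a finite union of points and intervals. A set is definable if it belongs to some $\mathcal{D}_n$; a mapping is definable if its graph is definable. $\mathbb{B}_r(x)$ is the open Euclidean ball of center $x$ and radius $r$; $\mathrm{co}$ denotes convex hull. For $A\in\mathbb{R}^{n\times n}$, $\sigma(A):=\inf_{\|v\|=1}\|Av\|$. $B_f$ is the set of points of $\mathbb{R}^n$ at which $f$ is not of class $C^1$ (i.e. $f$ is not $C^1$ on any neighbourhood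 of the point); it is a definable nowhere dense set. For $x\in\mathbb{R}^n\setminus B_f$, $df(x)$ is the derivative of $f$ at $x$; for $U\subset\mathbb{R}^n$, $df(U):=\{df(x): x\in U\setminus B_f\}$. For $x\in\mathbb{R}^n$, $$\nu_f(x):=\lim_{r\to0^+}\ \inf_{A\in\mathrm{co}(df(\mathbb{B}_r(x)))}\sigma(A)\in[0,+\infty].$$ *)

(* Defs.v *)
From HB Require Import structures.
From mathcomp Require Import all_boot all_order all_algebra.
From mathcomp Require Import all_classical all_reals all_analysis.
From mathcomp Require mpoly.

Set Implicit Arguments.
Unset Strict Implicit.
Unset Printing Implicit Defensive.
Import Order.TTheory GRing.Theory Num.Theory.
Import numFieldNormedType.Exports.
Local Open Scope classical_set_scope.
Local Open Scope ring_scope.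

Definition algebraic_set (R : realType) (n : nat) (X : set 'rV[R]_n) : Prop :=
  exists ps : seq (mpoly.mpoly n R),
    X = [set x | all (fun p => mpoly.meval (fun i => x 0 i) p == 0) ps].

(* In [omin_proj], ['rV_(n + 1)] stands for R^(n+1) and [lsubmx] is the
   projection on the first n coordinates. *)
Record omin_structure (R : realType) := OminStructure {
  omin_sets : forall n, set (set 'rV[R]_n) ;
  omin_setT : forall n, omin_sets [set: 'rV[R]_n] ;
  omin_setC : forall n (X : set 'rV[R]_n), omin_sets X -> omin_sets (~` X) ;
  omin_setU : forall n (X Y : set 'rV[R]_n),
    omin_sets X -> omin_sets Y -> omin_sets (X `|` Y) ;
  omin_prod : forall m n (X : set 'rV[R]_m) (Y : set 'rV[R]_n),
    omin_sets X -> omin_sets Y ->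
    @omin_sets (m + n) [set row_mx x y | x in X & y in Y] ;
  omin_proj : forall n (X : set 'rV[R]_(n + 1)),
    omin_sets X -> omin_sets [set lsubmx z | z in X] ;
  omin_alg : forall n (X : set 'rV[R]_n), algebraic_set X -> omin_sets X ;
  omin_tame : forall X : set 'rV[R]_1, omin_sets X ->
    exists (pts : seq R) (itvs : seq (interval R)),
      X = [set x | x 0 0 \in pts \/ exists2 i, i \in itvs & x 0 0 \in i] }.

Definition definable_map (R : realType) (D : omin_structure R) (m n : nat)
    (f : 'rV[R]_m -> 'rV[R]_n) : Prop :=
  omin_sets D (range (fun x => row_mx x (f x))).

Definition homeo_on (T S : topologicalType) (U : set T) (V : set S)
    (f : T -> S) : Prop :=
  {within U, continuous f} /\
  exists g : S -> T,
    [/\ {within V, continuous g},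
        {homo f : x / U x >-> V x}, {homo g : y / V y >-> U y},
        {in U, cancel f g} & {in V, cancel g f}].

Definition local_homeo (T S : topologicalType) (f : T -> S) : Prop :=
  forall x, exists U : set T,
    [/\ open U, U x, open (f @` U) & homeo_on U (f @` U) f].

Section Nu.
Context (R : realType) (n : nat).
Implicit Types (x : 'rV[R]_n) (f : 'rV[R]_n -> 'rV[R]_n).

(* The library norm on ['rV[R]_n] is the sup norm; it induces the same topology
   and the same notion of differentiability as the Euclidean one. *)
Definition enorm x : R := Num.sqrt (\sum_i x 0 i ^+ 2).

Definition eball x (r : R) : set 'rV[R]_n := [set y | enorm (y - x) < r].

(* Vectors are rows, so a matrix [A] acts by [v |-> v *m A]; in particular
   ['d f x v = v *m 'J f x].  The infimum is taken in [\bar R] (for [n = 0] the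
   unit sphere is empty and the value is [+oo]). *)
Definition sigma (A : 'M[R]_n) : \bar R :=
  ereal_inf [set (enorm (v *m A))%:E | v in [set v | enorm v = 1]].

Definition C1_near f x : Prop :=
  \forall y \near x, differentiable f y /\ {for y, continuous (jacobian f)}.

Definition nonC1 f : set 'rV[R]_n := [set x | ~ C1_near f x].

Definition dimage f (U : set 'rV[R]_n) : set 'M[R]_n :=
  [set 'J f x | x in U `\` nonC1 f].

Definition conv_hull (S : set 'M[R]_n) : set 'M[R]_n :=
  smallest (fun C : set 'M[R]_n => convex_set (C : set (convex_lmodType 'M[R]_n))) S.

Definition nu f x : \bar R :=
  lim (ereal_inf (sigma @` conv_hull (dimage f (eball x r))) @[r --> 0^'+]).

Definition K_infty f : set 'rV[R]_n :=
  [set y | exists x_ : nat -> 'rV[R]_n,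
    [/\ enorm (x_ k) @[k --> \oo] --> +oo,
        f (x_ k) @[k --> \oo] --> y &
        ((enorm (x_ k))%:E * nu f (x_ k))%E @[k --> \oo] --> 0%E]].

End Nu.

(* Main.v *)
(* Smoothness.  By induction on the dimension, if countably many definable sets
   cover a nonempty open set then one of them contains a nonempty open set:
   a slice of a definable set contains or misses a rational interval, and Baire's
   theorem selects one interval that works over an open set of the base.  This
   replaces cell decomposition.  For a continuous definable function the right
   derivative in a direction exists in [-oo, +oo] everywhere (tameness in
   dimension one); classifying points by its value up to [e] shows that the
   difference quotients are constant up to [e] near a dense set of points.
   Hence [f] is C^1 near a dense set of points.

   Expansion.  If [sigma A >= m] for all [A] in the convex hull of the Jacobians
   over a ball, then [enorm (f y - f x) >= m * enorm (y - x)] on that ball.  For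
   the direction [v] of [y - x], the convex set of all [v *m A] is separated from
   0 by a unit vector [w], so [dot w (f _)] grows with slope at least [m] along
   [v] near C^1 points; the covering property spreads this to all points.

   Lifting.  As [K_infty f] is empty, near every value and far enough from 0 the
   expansion rate at [x] is at least a multiple of [1 / enorm x].  A partial lift
   of a segment therefore grows at most exponentially, so it stays bounded and
   extends.  Lifting all segments issued from [f 0] yields a continuous section
   [g] of [f], and uniqueness of lifts gives [g (f x) = x]. *)
Require Import Defs.
From HB Require Import structures.
From mathcomp Require Import all_boot all_order all_algebra.
From mathcomp Require Import all_classical all_reals all_analysis.
From mathcomp Require Import lra ring.
From mathcomp Require mpoly.
Import (canonicals) mpoly.
Set Implicit Arguments.
Unset Strict Implicit.
Unset Printing Implicit Defensive.
Import Order.TTheory GRing.Theory Num.Theory.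
Import numFieldNormedType.Exports.
Local Open Scope classical_set_scope.
Local Open Scope ring_scope.

(** * Definable predicates and functions *)

Section Definability.
Context (R : realType) (D : omin_structure R).
Implicit Types n m k : nat.

Definition dset n (P : 'rV[R]_n -> Prop) := @omin_sets R D n P.

Lemma dset_ext n (P Q : 'rV[R]_n -> Prop) :
  (forall x, P x <-> Q x) -> dset Q -> dset P.
Proof. by move=> PQ; have -> : P = Q by apply/funext => x; apply/propext. Qed.

Lemma dset_not n (P : 'rV[R]_n -> Prop) : dset P -> dset (fun x => ~ P x).
Proof. exact: omin_setC. Qed.

Lemma dset_or n (P Q : 'rV[R]_n -> Prop) :
  dset P -> dset Q -> dset (fun x => P x \/ Q x).
Proof. exact: omin_setU. Qed.

Lemma dset_and n (P Q : 'rV[R]_n -> Prop) :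
  dset P -> dset Q -> dset (fun x => P x /\ Q x).
Proof.
move=> dP dQ; apply: (@dset_ext _ _ (fun x => ~ (~ P x \/ ~ Q x))); last first.
  by apply/dset_not/dset_or; exact: dset_not.
by move=> x; split=> [[? ?] []//|/not_orP[/contrapT ? /contrapT ?]].
Qed.

Lemma dset_imp n (P Q : 'rV[R]_n -> Prop) :
  dset P -> dset Q -> dset (fun x => P x -> Q x).
Proof.
move=> dP dQ; apply: (@dset_ext _ _ (fun x => ~ P x \/ Q x)); last first.
  by apply: dset_or => //; exact: dset_not.
move=> x; split=> [PQ|[nP /nP//|//]].
by have [/PQ|] := pselect (P x); [right|left].
Qed.

Lemma dset_const n (P : Prop) : dset (fun _ : 'rV[R]_n => P).
Proof.
have [p|np] := pselect P.
  by apply: (dset_ext _ (omin_setT D n)) => x; split.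
by apply: (dset_ext _ (dset_not (omin_setT D n))) => x; split => // /(_ Logic.I).
Qed.

Lemma dset_forall_seq n (I : eqType) (s : seq I) (P : I -> 'rV[R]_n -> Prop) :
  (forall i, dset (P i)) -> dset (fun x => forall i, i \in s -> P i x).
Proof.
move=> dP; elim: s => [|a s IH].
  by apply: (dset_ext _ (dset_const n True)) => x; split.
apply: (dset_ext _ (dset_and (dP a) IH)) => x; split.
  by move=> H; split=> [|i is_]; apply: H; rewrite inE ?eqxx// is_ orbT.
by move=> [Pa Ps] i; rewrite inE => /predU1P[->//|/Ps].
Qed.

Lemma dset_forall_fin n (I : finType) (P : I -> 'rV[R]_n -> Prop) :
  (forall i, dset (P i)) -> dset (fun x => forall i, P i x).
Proof.
move=> dP; apply: (dset_ext _ (dset_forall_seq (enum I) dP)) => x; split.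
  by move=> H i _; exact: H.
by move=> H i; apply: H; rewrite mem_enum.
Qed.

(** The projection axiom removes one coordinate at a time, hence the induction on [m]. The casts
    only reassociate the dimension [n + m.+1] as [n + m + 1]. *)
Lemma dset_exists_rV n m (Q : 'rV[R]_n -> 'rV[R]_m -> Prop) :
  dset (fun z : 'rV_(n + m) => Q (lsubmx z) (rsubmx z)) ->
  dset (fun x => exists y, Q x y).
Proof.
elim: m Q => [|m IH] Q dQ.
  have -> : (fun x => exists y, Q x y) = (fun x => Q x 0).
    by apply/funext => x; apply/propext; split=> [[y]|]; [rewrite (thinmx0 y)|exists 0].
  have E : (n + 0 = n)%N by rewrite addn0.
  (* Definability is transported along an equality of dimensions by eliminating that equality. *)
  have tr k (e : (n + 0 = k)%N) (P : 'rV_(n + 0) -> Prop) : dset P ->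
      dset (fun x : 'rV_k => P (castmx (erefl, esym e) x)).
    by case: _ / e => dP; apply: (dset_ext _ dP) => x; rewrite castmx_id.
  apply: (dset_ext _ (tr _ E _ dQ)) => x.
  have -> : rsubmx (castmx (erefl 1%N, esym E) x) = 0 by rewrite thinmx0.
  suff -> : lsubmx (castmx (erefl 1%N, esym E) x) = x by [].
  apply/rowP => i; rewrite mxE castmxE/=.
  by congr (x _ _); apply/val_inj.
pose e : (n + m.+1 = n + m + 1)%N := etrans (congr1 (addn n) (esym (addn1 m))) (addnA n m 1).
have tr k (e0 : (n + m.+1 = k)%N) (P : 'rV_(n + m.+1) -> Prop) : dset P ->
    dset (fun x : 'rV_k => P (castmx (erefl, esym e0) x)).
  by case: _ / e0 => dP; apply: (dset_ext _ dP) => x; rewrite castmx_id.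
have := omin_proj (tr _ e _ dQ).
pose jn (y : 'rV[R]_m) (t : 'rV[R]_1) : 'rV[R]_m.+1 :=
  castmx (erefl, addn1 m) (row_mx y t).
have jnE x y t : castmx (erefl, esym e) (row_mx (row_mx x y) t) = row_mx x (jn y t).
  apply/rowP => i; rewrite castmxE/= !ord1.
  case: (split_ordP i) => j ->; rewrite (row_mxEl, row_mxEr).
    have -> : cast_ord (esym (esym e)) (lshift m.+1 j) = lshift 1 (lshift m j).
      exact/val_inj.
    by rewrite !row_mxEl.
  rewrite castmxE/= ord1.
  set j' := cast_ord _ j; case: (split_ordP j') => l jl.
    have -> : cast_ord (esym (esym e)) (rshift n j) = lshift 1 (rshift n l).
      by apply/val_inj => /=; move/(congr1 val) : jl => /= ->.
    by rewrite jl !row_mxEl row_mxEr.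
  have -> : cast_ord (esym (esym e)) (rshift n j) = rshift (n + m) l.
    by apply/val_inj => /=; move/(congr1 val) : jl => /= ->; rewrite addnA.
  by rewrite jl !row_mxEr.
move=> H; apply: (@dset_ext _ _ (fun x => exists y, exists t, Q x (jn y t))).
  move=> x; split=> [[y Qy]|[y [t Qyt]]]; last by exists (jn y t).
  pose y' : 'rV_(m + 1) := castmx (erefl, esym (addn1 m)) y.
  exists (lsubmx y'), (rsubmx y').
  by rewrite /jn hsubmxK /y' castmxKV.
apply: IH; apply: (dset_ext _ H) => z /=; split.
  move=> [t Qt]; exists (row_mx z t); last by rewrite row_mxKl.
  by rewrite -[z]hsubmxK jnE row_mxKl row_mxKr.
move=> [w Qw <-]; exists (rsubmx w).
by move: Qw; rewrite -{1 2}[w]hsubmxK -{1 2}[lsubmx w]hsubmxK jnE row_mxKl row_mxKr.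
Qed.

Lemma dset_alg n (p q : 'rV[R]_n -> R) (P Q : mpoly.mpoly n R) :
  (forall x, p x = mpoly.meval (fun i => x 0 i) P) ->
  (forall x, q x = mpoly.meval (fun i => x 0 i) Q) ->
  dset (fun x => p x = q x).
Proof.
move=> pE qE; apply: omin_alg; exists [:: P - Q].
apply/seteqP; split => x /=; rewrite andbT mpoly.mevalB -pE -qE subr_eq0.
  by move/eqP.
by move/eqP.
Qed.

(** Permuting or repeating coordinates is a projection: the equations [x 0 (s i) = y 0 i] are
    linear, hence algebraic, and [y] is then eliminated. *)
Lemma dset_reindex n m (s : 'I_m -> 'I_n) (P : 'rV[R]_m -> Prop) :
  dset P -> dset (fun x : 'rV[R]_n => P (\row_i x 0 (s i))).
Proof.
move=> dP.
apply: (@dset_ext _ _ (fun x : 'rV[R]_n => exists y : 'rV[R]_m,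
   P y /\ forall i, x 0 (s i) = y 0 i)).
  move=> x; split=> [Px|[y [Py xy]]].
    by exists (\row_i x 0 (s i)); split=> // i; rewrite mxE.
  by have -> : \row_i x 0 (s i) = y by apply/rowP => i; rewrite mxE.
apply: dset_exists_rV; apply: dset_and.
  apply: (dset_ext _ (omin_prod (omin_setT D n) dP)) => z /=; split.
    by move=> Pz; exists (lsubmx z) => //; exists (rsubmx z) => //; rewrite hsubmxK.
  by move=> [x _ [y Py <-]]; rewrite row_mxKr.
apply: dset_forall_fin => i.
apply: (@dset_alg _ _ _ (mpoly.mpolyX R (mpoly.mnm1 (lshift m (s i))))
  (mpoly.mpolyX R (mpoly.mnm1 (rshift n i)))) => x;
  by rewrite mpoly.mevalXU !mxE.
Qed.

Definition dfunR n (u : 'rV[R]_n -> R) :=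
  dset (fun z : 'rV[R]_(n + 1) => z 0 (rshift n 0) = u (lsubmx z)).

(** Stated coordinate by coordinate, so that the closure properties reduce to scalar functions;
    [definable_dfun] derives it from the definability of the graph. *)
Definition dfun n m (u : 'rV[R]_n -> 'rV[R]_m) := forall i, dfunR (fun x => u x 0 i).

Lemma dset_comp n m (u : 'rV[R]_n -> 'rV[R]_m) (P : 'rV[R]_m -> Prop) :
  dfun u -> dset P -> dset (fun x => P (u x)).
Proof.
move=> du dP.
apply: (@dset_ext _ _ (fun x : 'rV[R]_n => exists y : 'rV[R]_m,
   P y /\ forall i, y 0 i = u x 0 i)).
  move=> x; split=> [Px|[y [Py xy]]]; first by exists (u x).
  by have -> : u x = y by apply/rowP => i.
apply: dset_exists_rV; apply: dset_and.
  apply: (dset_ext _ (dset_reindex (@rshift n m) dP)) => z.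
  suff -> : rsubmx z = \row_i z 0 (rshift n i) by [].
  by apply/rowP => i; rewrite !mxE.
apply: dset_forall_fin => i.
(* The graph of the [i]-th coordinate of [u] is read on the first block and on the [i]-th entry of
   the second block. *)
pose s (j : 'I_(n + 1)) : 'I_(n + m) :=
  match fintype.split j with inl a => lshift m a | inr _ => rshift n i end.
apply: (dset_ext _ (dset_reindex s (du i))) => z.
have -> : lsubmx (\row_j z 0 (s j)) = lsubmx z.
  by apply/rowP => j; rewrite !mxE /s (unsplitK (inl _)).
by rewrite !mxE /s (unsplitK (inr _)).
Qed.

Lemma dfunR_alg n (u : 'rV[R]_n -> R) (P : mpoly.mpoly (n + 1) R) :
  (forall x, u (lsubmx x) = mpoly.meval (fun i => x 0 i) P) -> dfunR u.
Proof.
apply: (@dset_alg _ _ _ (mpoly.mpolyX R (mpoly.mnm1 (rshift n 0)))) => x.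
by rewrite mpoly.mevalXU.
Qed.

Lemma dfunR_coord0 n i : dfunR (fun x : 'rV[R]_n => x 0 i).
Proof.
apply: (@dfunR_alg _ _ (mpoly.mpolyX R (mpoly.mnm1 (lshift 1 i)))) => x.
by rewrite mpoly.mevalXU mxE.
Qed.

Lemma dfun_id n : dfun (fun x : 'rV[R]_n => x).
Proof. by move=> i; exact: dfunR_coord0. Qed.

Lemma dfunR_const n c : dfunR (fun x : 'rV[R]_n => c).
Proof. by apply: (@dfunR_alg _ _ (mpoly.mpolyC _ c)) => x; rewrite mpoly.mevalC. Qed.

Lemma dfun_const n m (c : 'rV[R]_m) : dfun (fun x : 'rV[R]_n => c).
Proof. by move=> i; exact: dfunR_const. Qed.

Lemma dfunR_coord n m (u : 'rV[R]_n -> 'rV[R]_m) i :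
  dfun u -> dfunR (fun x => u x 0 i).
Proof. exact. Qed.

Lemma dfunR_reindex n m (s : 'I_m -> 'I_n) (u : 'rV[R]_m -> R) :
  dfunR u -> dfunR (fun x : 'rV[R]_n => u (\row_i x 0 (s i))).
Proof.
move=> du; pose s' (j : 'I_(m + 1)) : 'I_(n + 1) :=
  match fintype.split j with inl a => lshift 1 (s a) | inr a => rshift n a end.
apply: (dset_ext _ (dset_reindex s' du)) => z.
have -> : \row_i lsubmx z 0 (s i) = lsubmx (\row_j z 0 (s' j)).
  by apply/rowP => j; rewrite !mxE /s' (unsplitK (inl _)).
by rewrite mxE /s' (unsplitK (inr _)).
Qed.

Lemma dfun_row_mx n m k (u : 'rV[R]_n -> 'rV[R]_m) (v : 'rV[R]_n -> 'rV[R]_k) :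
  dfun u -> dfun v -> dfun (fun x => row_mx (u x) (v x)).
Proof.
move=> du dv i; case: (split_ordP i) => j ->.
  by have -> : (fun x => row_mx (u x) (v x) 0 (lshift k j)) = fun x => u x 0 j
    by apply/funext => x; rewrite row_mxEl.
by have -> : (fun x => row_mx (u x) (v x) 0 (rshift m j)) = fun x => v x 0 j
    by apply/funext => x; rewrite row_mxEr.
Qed.

(** The graph of the composite is the preimage of the graph of [g] under [(x, t) |-> (u x, t)]. *)
Lemma dfunR_comp n m (u : 'rV[R]_n -> 'rV[R]_m) (g : 'rV[R]_m -> R) :
  dfun u -> dfunR g -> dfunR (fun x => g (u x)).
Proof.
move=> du dg.
pose w (z : 'rV[R]_(n + 1)) := row_mx (u (lsubmx z)) (rsubmx z).
have dw : dfun w.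
  apply: dfun_row_mx => [i|i]; last first.
    have -> : (fun z : 'rV[R]_(n + 1) => rsubmx z 0 i) = fun z => z 0 (rshift n i).
      by apply/funext => z; rewrite mxE.
    exact: dfunR_coord0.
  have := dfunR_reindex (@lshift n 1) (du i).
  congr dfunR; apply/funext => z; congr (u _ 0 i).
  by apply/rowP => j; rewrite !mxE.
apply: (dset_ext _ (dset_comp dw dg)) => z.
by rewrite /w row_mxKl row_mxEr !mxE.
Qed.

Lemma dfun_comp n m k (u : 'rV[R]_n -> 'rV[R]_m) (g : 'rV[R]_m -> 'rV[R]_k) :
  dfun u -> dfun g -> dfun (fun x => g (u x)).
Proof. by move=> du dg i; exact: dfunR_comp du (dg i). Qed.

Lemma dfun_lsubmx n m k (u : 'rV[R]_n -> 'rV[R]_(m + k)) :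
  dfun u -> dfun (fun x => lsubmx (u x)).
Proof.
move=> du; apply: (dfun_comp (g := lsubmx)) du _ => i.
have -> : (fun x => lsubmx x 0 i) = fun x : 'rV[R]_(m + k) => x 0 (lshift k i).
  by apply/funext => x; rewrite mxE.
exact: dfunR_coord0.
Qed.

Lemma dfun_rsubmx n m k (u : 'rV[R]_n -> 'rV[R]_(m + k)) :
  dfun u -> dfun (fun x => rsubmx (u x)).
Proof.
move=> du; apply: (dfun_comp (g := rsubmx)) du _ => i.
have -> : (fun x => rsubmx x 0 i) = fun x : 'rV[R]_(m + k) => x 0 (rshift m i).
  by apply/funext => x; rewrite mxE.
exact: dfunR_coord0.
Qed.

(** The sum is the pair [(u, v)] followed by addition on the plane, which is polynomial. *)
Lemma dfunR_add n (u v : 'rV[R]_n -> R) :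
  dfunR u -> dfunR v -> dfunR (fun x => u x + v x).
Proof.
move=> du dv; pose w (x : 'rV[R]_n) : 'rV[R]_2 := \row_i (if i == 0 then u x else v x).
have dw : dfun w.
  move=> i; have -> : (fun x => w x 0 i) = if i == 0 then u else v.
    by apply/funext => x; rewrite mxE; case: ifP.
  by case: ifP.
have : dfunR (fun z : 'rV[R]_2 => z 0 0 + z 0 1).
  apply: (@dfunR_alg _ _ (mpoly.mpolyX R (mpoly.mnm1 (lshift 1 0)) +
     mpoly.mpolyX R (mpoly.mnm1 (lshift 1 1)))) => x.
  by rewrite mpoly.mevalD !mpoly.mevalXU !mxE.
by move=> /(dfunR_comp dw); congr dfunR; apply/funext => x; rewrite !mxE.
Qed.

Lemma dfunR_mul n (u v : 'rV[R]_n -> R) :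
  dfunR u -> dfunR v -> dfunR (fun x => u x * v x).
Proof.
move=> du dv; pose w (x : 'rV[R]_n) : 'rV[R]_2 := \row_i (if i == 0 then u x else v x).
have dw : dfun w.
  move=> i; have -> : (fun x => w x 0 i) = if i == 0 then u else v.
    by apply/funext => x; rewrite mxE; case: ifP.
  by case: ifP.
have : dfunR (fun z : 'rV[R]_2 => z 0 0 * z 0 1).
  apply: (@dfunR_alg _ _ (mpoly.mpolyX R (mpoly.mnm1 (lshift 1 0)) *
     mpoly.mpolyX R (mpoly.mnm1 (lshift 1 1)))) => x.
  by rewrite mpoly.mevalM !mpoly.mevalXU !mxE.
by move=> /(dfunR_comp dw); congr dfunR; apply/funext => x; rewrite !mxE.
Qed.

Lemma dfunR_opp n (u : 'rV[R]_n -> R) : dfunR u -> dfunR (fun x => - u x).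
Proof.
move=> /(dfunR_mul (dfunR_const _ (-1))); congr dfunR; apply/funext => x.
by rewrite mulN1r.
Qed.

Lemma dfunR_sum n (I : finType) (u : I -> 'rV[R]_n -> R) :
  (forall i, dfunR (u i)) -> dfunR (fun x => \sum_i u i x).
Proof.
move=> du; elim: (index_enum I) => [|i s IH].
  have := dfunR_const n 0; congr dfunR; by apply/funext => x; rewrite big_nil.
have := dfunR_add (du i) IH; congr dfunR; by apply/funext => x; rewrite big_cons.
Qed.

Lemma dfun_add n m (u v : 'rV[R]_n -> 'rV[R]_m) :
  dfun u -> dfun v -> dfun (fun x => u x + v x).
Proof.
move=> du dv i; have := dfunR_add (du i) (dv i); congr dfunR.
by apply/funext => x; rewrite !mxE.
Qed.

Lemma dfun_scale n m (c : 'rV[R]_n -> R) (u : 'rV[R]_n -> 'rV[R]_m) :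
  dfunR c -> dfun u -> dfun (fun x => c x *: u x).
Proof.
move=> dc du i; have := dfunR_mul dc (du i); congr dfunR.
by apply/funext => x; rewrite !mxE.
Qed.

Lemma dset_eq n (u v : 'rV[R]_n -> R) :
  dfunR u -> dfunR v -> dset (fun x => u x = v x).
Proof.
move=> du dv.
pose w (x : 'rV[R]_n) : 'rV[R]_(n + 1) := row_mx x (u x)%:M.
have dw : dfun w.
  apply: dfun_row_mx; first exact: dfun_id.
  move=> i; suff -> : (fun x => (u x)%:M 0 i) = u by [].
  by apply/funext => x; rewrite !mxE ord1.
apply: (dset_ext _ (dset_comp dw dv)) => x.
by rewrite /w row_mxEr row_mxKl !mxE mulr1n.
Qed.

Lemma dset_exists n (Q : 'rV[R]_n -> R -> Prop) :
  dset (fun z : 'rV_(n + 1) => Q (lsubmx z) (rsubmx z 0 0)) ->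
  dset (fun x => exists t, Q x t).
Proof.
move=> dQ; apply: (@dset_ext _ _ (fun x => exists t : 'rV_1, Q x (t 0 0))).
  by move=> x; split=> [[t Qt]|[t Qt]]; [exists t%:M; rewrite mxE|exists (t 0 0)].
exact: dset_exists_rV.
Qed.

Lemma dset_forall n (Q : 'rV[R]_n -> R -> Prop) :
  dset (fun z : 'rV_(n + 1) => Q (lsubmx z) (rsubmx z 0 0)) ->
  dset (fun x => forall t, Q x t).
Proof.
move=> dQ; apply: (@dset_ext _ _ (fun x => ~ exists t, ~ Q x t)).
  by move=> x; split=> [H [t]|/forallNP H t]; [exact|exact: contrapT (H t)].
by apply/dset_not/dset_exists/dset_not.
Qed.

Lemma dset_forall_rV n m (Q : 'rV[R]_n -> 'rV[R]_m -> Prop) :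
  dset (fun z : 'rV_(n + m) => Q (lsubmx z) (rsubmx z)) ->
  dset (fun x => forall y, Q x y).
Proof.
move=> dQ; apply: (@dset_ext _ _ (fun x => ~ exists t, ~ Q x t)).
  by move=> x; split=> [H [t]|/forallNP H t]; [exact|exact: contrapT (H t)].
by apply/dset_not/dset_exists_rV/dset_not.
Qed.

(** The order is definable because the nonnegative reals are the squares. *)
Lemma dset_le n (u v : 'rV[R]_n -> R) :
  dfunR u -> dfunR v -> dset (fun x => u x <= v x).
Proof.
move=> du dv.
apply: (@dset_ext _ _ (fun x => exists t, v x = u x + t * t)).
  move=> x; split=> [uv|[t ->]]; last by rewrite lerDl -expr2 sqr_ge0.
  exists (Num.sqrt (v x - u x)).
  by rewrite -expr2 sqr_sqrtr ?subr_ge0// addrC subrK.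
have dl (h : 'rV[R]_n -> R) : dfunR h -> dfunR (fun x : 'rV_(n + 1) => h (lsubmx x)).
  by apply: dfunR_comp; apply: dfun_lsubmx; exact: dfun_id.
have dr : dfunR (fun x : 'rV[R]_(n + 1) => rsubmx x 0 0).
  by apply: dfunR_coord; apply: dfun_rsubmx; exact: dfun_id.
apply: dset_exists; apply: dset_eq; first exact: dl.
by apply: dfunR_add; [exact: dl|exact: dfunR_mul].
Qed.

Lemma dset_lt n (u v : 'rV[R]_n -> R) :
  dfunR u -> dfunR v -> dset (fun x => u x < v x).
Proof.
move=> du dv; apply: (dset_ext _ (dset_not (dset_le dv du))) => x.
by rewrite ltNge; split=> /negP.
Qed.

Lemma definable_dfun n m (f : 'rV[R]_n -> 'rV[R]_m) : definable_map D f -> dfun f.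
Proof.
move=> df i.
apply: (@dset_ext _ _ (fun z : 'rV[R]_(n + 1) => exists y : 'rV[R]_m,
   range (fun x => row_mx x (f x)) (row_mx (lsubmx z) y) /\
   z 0 (rshift n 0) = y 0 i)).
  move=> z; split=> [zf|[y [[x _ /eq_row_mx[-> ->]] ->//]]].
  by exists (f (lsubmx z)); split=> //; exists (lsubmx z).
apply: dset_exists_rV; apply: dset_and.
  apply: dset_comp df; apply: dfun_row_mx.
    by apply/dfun_lsubmx/dfun_lsubmx/dfun_id.
  by apply/dfun_rsubmx/dfun_id.
apply: dset_eq; first by apply/dfunR_coord/dfun_lsubmx/dfun_id.
by apply/dfunR_coord/dfun_rsubmx/dfun_id.
Qed.

End Definability.

(** * Baire category for definable sets *)

Lemma near_rightP (R : realFieldType) (a : R) (P : R -> Prop) :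
  (\forall t \near a^'+, P t) <-> exists2 d, 0 < d & forall t, a < t -> t < a + d -> P t.
Proof.
split=> [[d /= d0 aP]|[d d0 aP]].
  exists d => // t at_ td; apply: aP => //=.
  by rewrite ltr_norml; apply/andP; split; lra.
near=> t; apply: aP; first by near: t; exact: nbhs_right_gt.
by near: t; apply: nbhs_right_lt; rewrite ltrDl.
Unshelve. all: by end_near. Qed.

Section Category.
Context (R : realType) (D : omin_structure R).
Implicit Types n : nat.

Lemma near_right_orVN (a : R) (P Q : R -> Prop) :
  (\forall t \near a^'+, P t) \/ (\forall t \near a^'+, ~ P t) ->
  (\forall t \near a^'+, Q t) \/ (\forall t \near a^'+, ~ Q t) ->
  (\forall t \near a^'+, P t \/ Q t) \/ (\forall t \near a^'+, ~ (P t \/ Q t)).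
Proof.
move=> [HP|HP]; first by left; apply: filterS HP; left.
move=> [HQ|HQ]; first by left; apply: filterS HQ; right.
by right; apply: filterS2 HP HQ => t nP nQ [].
Qed.

Lemma near_right_itv (a : R) (i : interval R) :
  (\forall t \near a^'+, t \in i) \/ (\forall t \near a^'+, ~ t \in i).
Proof.
case: i => l u.
have Hl : (\forall t \near a^'+, (l <= BLeft t)%O) \/
          (\forall t \near a^'+, ~ (l <= BLeft t)%O).
  case: l => [b x|[]]; [|by left; near=> t|by right; near=> t].
  case: (leP x a) => xa.
    left; near=> t; have at_ : a < t by near: t; exact: nbhs_right_gt.
    have xt := le_lt_trans xa at_.
    by case: b; rewrite bnd_simp ?xt ?(ltW xt).
  right; near=> t; have tx : t < x by near: t; exact: nbhs_right_lt.
  by apply/negP; case: b; rewrite bnd_simp -?ltNge -?leNgt ?(ltW tx) ?tx.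
have Hu : (\forall t \near a^'+, (BRight t <= u)%O) \/
          (\forall t \near a^'+, ~ (BRight t <= u)%O).
  case: u => [b x|[]]; [|by right; near=> t|by left; near=> t].
  case: (leP x a) => xa.
    right; near=> t; have at_ : a < t by near: t; exact: nbhs_right_gt.
    have xt := le_lt_trans xa at_.
    by apply/negP; case: b; rewrite bnd_simp -?ltNge -?leNgt ?xt ?(ltW xt).
  left; near=> t; have tx : t < x by near: t; exact: nbhs_right_lt.
  by case: b; rewrite bnd_simp ?(ltW tx) ?tx.
case: Hl => Hl; last first.
  by right; apply: filterS Hl => t; rewrite itv_boundlr => + /andP[].
case: Hu => Hu; last first.
  by right; apply: filterS Hu => t; rewrite itv_boundlr => + /andP[].
by left; apply: filterS2 Hl Hu => t lt tu; rewrite itv_boundlr lt tu.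
Unshelve. all: by end_near. Qed.

(** The form in which tameness is used: a point or an interval is decided just to the right of [a],
    and this dichotomy is stable under finite unions. *)
Lemma dset_near_right (P : R -> Prop) (a : R) :
  dset D (fun x : 'rV_1 => P (x 0 0)) ->
  (\forall t \near a^'+, P t) \/ (\forall t \near a^'+, ~ P t).
Proof.
move=> /omin_tame [pts [itvs E]].
have PE t : P t <-> t \in pts \/ exists2 i, i \in itvs & t \in i.
  have /(congr1 (fun X => X t%:M)) := E.
  by rewrite /= !mxE mulr1n => ->.
have [H|H] : (\forall t \near a^'+, t \in pts \/ exists2 i, i \in itvs & t \in i) \/
    (\forall t \near a^'+, ~ (t \in pts \/ exists2 i, i \in itvs & t \in i)); last first.
- by right; apply: filterS H => t + Pt; apply; apply/PE.
- by left; apply: filterS H => t /PE.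
apply: near_right_orVN.
  elim: pts {E PE} => [|p s IH]; first by right; near=> t.
  have : (\forall t \near a^'+, t = p \/ t \in s) \/
         (\forall t \near a^'+, ~ (t = p \/ t \in s)).
    apply: near_right_orVN => //; right.
    case: (leP p a) => pa; near=> t => tp.
      have : a < t by near: t; exact: nbhs_right_gt.
      by rewrite tp ltNge pa.
    have : t < p by near: t; exact: nbhs_right_lt.
    by rewrite tp ltxx.
  move=> [H|H]; [left|right]; apply: filterS H => t.
    by rewrite inE => -[->|->]; rewrite ?eqxx ?orbT.
  by move=> nH; rewrite inE => /predU1P ?; exact: nH.
elim: itvs {E PE} => [|i s IH]; first by right; near=> t; case.
have : (\forall t \near a^'+, t \in i \/ exists2 i, i \in s & t \in i) \/
       (\forall t \near a^'+, ~ (t \in i \/ exists2 i, i \in s & t \in i)).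
  by apply: near_right_orVN => //; exact: near_right_itv.
move=> [H|H]; [left|right]; apply: filterS H => t.
  move=> [ti|[j js tj]]; first by exists i; rewrite ?inE ?eqxx.
  by exists j; rewrite ?inE ?js ?orbT.
move=> nH [j]; rewrite inE => /predU1P[->|js] tj; apply: nH; first by left.
by right; exists j.
Unshelve. all: by end_near. Qed.

Lemma dset_near_right_line n (P : 'rV[R]_n -> Prop) (x v : 'rV[R]_n) (a : R) :
  dset D P ->
  (\forall t \near a^'+, P (x + t *: v)) \/
  (\forall t \near a^'+, ~ P (x + t *: v)).
Proof.
move=> dP; apply: (dset_near_right (P := fun t => P (x + t *: v))).
apply: (dset_comp (u := fun t : 'rV_1 => x + t 0 0 *: v)) dP.
apply: dfun_add; first exact: dfun_const.
by apply: dfun_scale; [exact: dfunR_coord0|exact: dfun_const].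
Qed.

Lemma lsubmx_continuous n m : continuous (fun z : 'rV[R]_(n + m) => lsubmx z).
Proof.
move=> z A /nbhs_ballP[e e0 zA]; apply/nbhs_ballP; exists e => //= w [_ zw].
by apply: zA; split => // i j; rewrite !mxE; exact: zw.
Qed.

(** This property and [baire_cover] are proved by a joint induction: the dichotomy in dimension [n]
    gives the cover property in dimension [n], which gives the dichotomy in dimension [n + 1]. *)
Definition baire_dichotomy n := forall P : 'rV[R]_n -> Prop, dset D P ->
  forall B : set 'rV[R]_n, open B -> B !=set0 -> exists U : set 'rV[R]_n,
  [/\ open U, U !=set0, U `<=` B & U `<=` P \/ U `<=` ~` P].

Definition baire_cover n := forall (I : countType) (X : I -> 'rV[R]_n -> Prop)
  (B : set 'rV[R]_n), (forall k, dset D (X k)) -> open B -> B !=set0 ->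
  (forall x, B x -> exists k, X k x) -> exists k (U : set 'rV[R]_n),
  [/\ open U, U !=set0, U `<=` B & U `<=` X k].

HB.instance Definition _ n := Complete.on (matrix R 1 n).

(** If no [X i] contained an open part of [B], the dichotomy would make the interior of the
    complement of each [B] [&] [X i] dense, and Baire's theorem would give a point of [B] in no
    [X i]. *)
Lemma dichotomy_cover n : baire_dichotomy n -> baire_cover n.
Proof.
move=> BP I X B dX oB B0 cov; apply: contrapT => /forallNP noX.
(* Baire's theorem takes a sequence, so the countable index type is decoded from [nat]; codes of
   nothing give the empty set. *)
pose Y k : set 'rV[R]_n := [set x | exists2 i : I, unpickle k = Some i & X i x].
pose F k := (~` (B `&` Y k))°.
have FP k : open (F k) /\ dense (F k).
  split; first exact: open_interior.
  move=> O O0 oO.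
  have [[z [Oz Bz]]|/forallNP OB0] := pselect (exists z, O z /\ B z); last first.
    have [z Oz] := O0; exists z; split => //.
    have := open_nbhs_nbhs (conj oO Oz); apply: filterS => w Ow [Bw _].
    by apply: (OB0 w).
  case Ek : (unpickle k : option I) => [i|]; last first.
    exists z; split => //.
    have : nbhs z setT by exact: filterT.
    by apply: filterS => w _ [_ [i]]; rewrite Ek.
  have [U [oU [u Uu] UOB UX]] := BP _ (dX i) _ (openI oO oB) (ex_intro _ z (conj Oz Bz)).
  case: UX => UX.
    exfalso; apply: (noX i); exists U; split=> //; first by exists u.
    by move=> w /UOB[].
  exists u; split; first by case: (UOB _ Uu).
  have := open_nbhs_nbhs (conj oU Uu); apply: filterS => w Uw [_ [j]].
  by rewrite Ek => -[<-]; exact: UX.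
have [x [Bx Fx]] := @Baire R 'rV[R]_n F FP _ B0 oB.
have [i Xix] := cov _ Bx.
have /interior_subset := Fx (pickle i) Logic.I; apply; split => //.
by exists i => //; rewrite pickleK.
Qed.

(** Tameness to the right of [t0] makes each vertical slice constant on some rational interval. The
    cover property fixes the interval and the answer over an open base, and the product of the two
    is the open set sought. *)
Lemma cover_dichotomy n : baire_cover n -> baire_dichotomy (n + 1).
Proof.
move=> CL P dP B oB [z0 Bz0].
have /nbhs_ballP[e /= e0 zB] := open_nbhs_nbhs (conj oB Bz0).
set x0 := lsubmx z0; set t0 : R := z0 0 (rshift n 0).
have boxB x t : ball x0 e x -> ball t0 e t -> B (row_mx x t%:M).
  move=> [_ xx] tt; apply: zB; split => // i j; rewrite ord1.
  case: (split_ordP j) => k ->; rewrite (row_mxEl, row_mxEr).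
    by have := xx 0 k; rewrite mxE.
  by rewrite ord1 mxE mulr1n.
have zE (z : 'rV[R]_(n + 1)) : z = row_mx (lsubmx z) (z 0 (rshift n 0))%:M.
  rewrite -[LHS]hsubmxK; congr row_mx; apply/rowP => i.
  by rewrite ord1 !mxE mulr1n.
(* [X (p, q, b)]: the slice over the interval (p, q) lies in [P] if [b], and
   misses [P] otherwise. *)
pose X (k : rat * rat * bool) (x : 'rV[R]_n) :=
  (t0 < ratr k.1.1 /\ ratr k.1.1 < ratr k.1.2 :> R /\ ratr k.1.2 < t0 + e) /\
  forall t, ratr k.1.1 < t -> t < ratr k.1.2 ->
    (k.2 -> P (row_mx x t%:M)) /\ (~ k.2 -> ~ P (row_mx x t%:M)).
have dX k : dset D (X k).
  apply: dset_and; first exact: dset_const.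
  have dPl : dset D (fun z : 'rV_(n + 1) => P (row_mx (lsubmx z) (rsubmx z 0 0)%:M)).
    apply: (dset_ext _ dP) => z.
    by have -> : row_mx (lsubmx z) (rsubmx z 0 0)%:M = z by rewrite [RHS]zE mxE.
  have dt : dfunR D (fun z : 'rV_(n + 1) => rsubmx z 0 0).
    by apply/dfunR_coord/dfun_rsubmx/dfun_id.
  apply: dset_forall; apply: dset_imp.
    by apply: dset_lt => //; exact: dfunR_const.
  apply: dset_imp; first by apply: dset_lt => //; exact: dfunR_const.
  by apply: dset_and; apply: dset_imp => //; [exact: dset_const|exact: dset_const|exact: dset_not].
have [||k [U [oU [u Uu] Ux0 UX]]] := CL _ X (ball x0 e) dX (ball_open x0 e).
- by exists x0; exact: ballxx.
- move=> x x0x.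
  have T : (\forall t \near t0^'+, P (row_mx x 0 + t *: row_mx 0 1)) \/
    (\forall t \near t0^'+, ~ P (row_mx x 0 + t *: row_mx 0 1)).
    exact: dset_near_right_line.
  have rowE t : row_mx x 0 + t *: row_mx 0 1 = row_mx x t%:M.
    by rewrite scale_row_mx add_row_mx scaler0 addr0 add0r scalemx1.
  have K (Q : R -> Prop) : (\forall t \near t0^'+, Q t) -> exists p q : rat,
      (t0 < ratr p /\ ratr p < ratr q :> R /\ ratr q < t0 + e) /\
      forall t, ratr p < t -> t < ratr q -> Q t.
    move=> /near_rightP[d d0 HQ].
    have tm : t0 < t0 + Num.min d e by rewrite ltrDl lt_min d0.
    have [q /[!in_itv]/= /andP[tq qm]] := rat_in_itvoo tm.
    have [p /[!in_itv]/= /andP[tp pq]] := rat_in_itvoo tq.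
    have qe : ratr q < t0 + e by rewrite (lt_le_trans qm)// lerD2l ge_min lexx orbT.
    exists p, q; split=> // t pt tq'; apply: HQ; first exact: lt_trans pt.
    by rewrite (lt_trans tq')// (lt_le_trans qm)// lerD2l ge_min lexx.
  case: T => /K[p [q [pq HQ]]]; [exists (p, q, true)|exists (p, q, false)];
    split => // t pt tq; have := HQ t pt tq; rewrite rowE; split=> //.
exists [set z | U (lsubmx z) /\ ratr k.1.1 < z 0 (rshift n 0) /\ z 0 (rshift n 0) < ratr k.1.2].
have [[k1 [k2 k3]] _] := UX _ Uu.
split.
- apply: openI; first by apply: open_comp oU => z _; exact: lsubmx_continuous.
  have oc (A : set R) : open A -> open [set z : 'rV[R]_(n + 1) | A (z 0 (rshift n 0))].
    by apply: open_comp => z _; exact: coord_continuous.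
  apply: openI; first by apply: (oc [set t | ratr k.1.1 < t]); exact: open_gt.
  by apply: (oc [set t | t < ratr k.1.2]); exact: open_lt.
- exists (row_mx u ((ratr k.1.1 + ratr k.1.2) / 2)%:M).
  rewrite /= row_mxKl row_mxEr mxE mulr1n; split=> //.
  by move: k2; set p := ratr _; set q := ratr _ => pq; split; lra.
- move=> z [Uz [z1 z2]].
  rewrite [z]zE; apply: boxB; first exact: Ux0.
  rewrite -ball_normE /= ltr_norml; move: k1 k2 k3 z1 z2.
  by set p := ratr _; set q := ratr _; set t := z _ _ => *; apply/andP; split; lra.
- case: k dX UX k1 k2 k3 => [[p q] b] /= dX UX k1 k2 k3.
  case: b dX UX => dX UX; [left|right] => z [/UX[_ /= +] [z1 z2]];
    move=> /(_ _ z1 z2)[]; rewrite -zE => T1 T2; [exact: T1|exact: T2].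
Qed.

Lemma dset_dichotomy n : baire_dichotomy n.
Proof.
elim: n => [|n IH]; last by rewrite -addn1; exact/cover_dichotomy/dichotomy_cover.
move=> P _ B oB [z Bz]; exists B; split=> //; first by exists z.
have [Pz|nPz] := pselect (P z); [left|right] => w _;
  by rewrite (thinmx0 w) -(thinmx0 z).
Qed.

Lemma dset_cover n : baire_cover n.
Proof. exact/dichotomy_cover/dset_dichotomy. Qed.

End Category.

(** * Slopes along a direction *)

(** The supremum of the [t] such that [P] holds on [[a, t]] satisfies [P] by left closure, and right
    openness forbids it to be smaller than [b]. *)
Lemma real_induction (R : realType) (a b : R) (P : R -> Prop) :
  P a ->
  (forall t, a <= t -> t < b -> P t ->
    exists2 d, 0 < d & forall s, t < s -> s < t + d -> P s) ->
  (forall t, a < t -> t <= b -> (forall s, a <= s -> s < t -> P s) -> P t) ->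
  forall t, a <= t -> t <= b -> P t.
Proof.
move=> Pa Pr Pl t0 at0 t0b; have ab := le_trans at0 t0b.
pose S : set R := [set t | a <= t <= b /\ forall s, a <= s -> s <= t -> P s].
have Sa : S a.
  split; first by rewrite lexx.
  by move=> s sa as_; have -> : s = a by apply/eqP; rewrite eq_le sa as_.
have hS : has_sup S by split; [exists a|exists b => t [/andP[]]].
have aT : a <= sup S by apply: sup_upper_bound.
have Tb : sup S <= b by apply: ge_sup; [exists a|move=> t [/andP[]]].
have PltT s : a <= s -> s < sup S -> P s.
  move=> as_ /(sup_gt (ex_intro _ a Sa))[t [_ H] st].
  by apply: H => //; exact: ltW.
have PT : P (sup S).
  have [<-//|] := eqVneq a (sup S).
  move=> aneT; apply: Pl => //; rewrite lt_neqAle aneT //.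
have PleT s : a <= s -> s <= sup S -> P s.
  by move=> as_; rewrite le_eqVlt => /orP[/eqP->//|]; exact: PltT.
have [Tlt|Tge] := ltP (sup S) b; last by apply: PleT => //; exact: le_trans Tge.
have [d d0 dP] := Pr _ aT Tlt PT.
pose m := Num.min d (b - sup S) / 2.
have m0 : 0 < m by rewrite divr_gt0 // lt_min d0 subr_gt0.
have mind : Num.min d (b - sup S) <= d by rewrite ge_min lexx.
have minb : Num.min d (b - sup S) <= b - sup S by rewrite ge_min lexx orbT.
have md : m < d by rewrite /m in m0 *; lra.
have mb : m <= b - sup S by rewrite /m in m0 *; lra.
have : S (sup S + m).
  split; first by apply/andP; split; lra.
  move=> s as_ sm; have [sT|Ts] := leP s (sup S); first exact: PleT.
  by apply: dP => //; lra.
by move=> /(sup_upper_bound hS); lra.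
Qed.

(** Real induction on [h a <= h t]: the hypothesis moves it to the right, and continuity preserves
    it at limits from the left. *)
Lemma dini_le (R : realType) (h : R -> R) (a b : R) : a <= b ->
  (forall t, a < t -> t <= b -> {for t, continuous h}) ->
  (forall t, a <= t -> t < b -> \forall s \near t^'+, h t <= h s) ->
  h a <= h b.
Proof.
move=> ab hc hr; apply: (@real_induction R a b (fun t => h a <= h t)) => //.
  move=> t at_ tb hat; have /near_rightP[d d0 H] := hr _ at_ tb.
  by exists d => // s ts sd; exact: le_trans hat (H _ ts sd).
move=> t at_ tb H; rewrite leNgt; apply/negP => ha.
have : \forall s \near t, h s < h a by exact: (cvgr_lt (h t) (hc _ at_ tb) _ ha).
move=> /nbhs_ballP[e /= e0 He].
have := He (Num.max a (t - e / 2)).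
have ms : Num.max a (t - e / 2) < t by rewrite gt_max at_; lra.
have ma : a <= Num.max a (t - e / 2) by rewrite le_max lexx.
have me : t - e / 2 <= Num.max a (t - e / 2) by rewrite le_max lexx orbT.
rewrite ltNge (H _ ma ms); move: ms ma me; set m := Num.max _ _ => ms ma me.
have : ball t e m by rewrite -ball_normE /= ltr_norml; apply/andP; split; lra.
by move=> b1 /(_ b1).
Qed.

Section Slopes.
Context (R : realType) (D : omin_structure R) (n : nat).
Implicit Types (phi : 'rV[R]_n -> R) (x v : 'rV[R]_n).

(** Balls are those of the sup norm, so membership is a finite conjunction of linear inequalities.
    The positivity of the radius is part of it and matters when [m = 0]. *)
Lemma dset_ball k m (x y : 'rV[R]_k -> 'rV[R]_m) (d : 'rV[R]_k -> R) :
  dfun D x -> dfun D y -> dfunR D d -> dset D (fun z => ball (x z) (d z) (y z)).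
Proof.
move=> dx dy dd; apply: (@dset_ext _ _ _ _ (fun z => 0 < d z /\
    forall i, x z 0 i - y z 0 i < d z /\ - d z < x z 0 i - y z 0 i)).
  move=> z; split.
    move=> [d0 H]; split=> // i; have := H 0 i.
    by rewrite -ball_normE /= ltr_norml => /andP[].
  move=> [d0 H]; split=> // i j; rewrite ord1 -ball_normE /= ltr_norml.
  by apply/andP; have [] := H j.
apply: dset_and; first by apply: dset_lt => //; exact: dfunR_const.
apply: dset_forall_fin => i.
have dxy : dfunR D (fun z => x z 0 i - y z 0 i).
  by apply: dfunR_add; [exact: dx|apply: dfunR_opp; exact: dy].
by apply: dset_and; apply: dset_lt => //; exact: dfunR_opp.
Qed.

Lemma dfunR_norm k (u : 'rV[R]_k -> R) : dfunR D u -> dfunR D (fun z => `|u z|).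
Proof.
move=> du; have duu : dfunR D (fun z : 'rV_(k + 1) => u (lsubmx z)).
  by apply: dfunR_comp du; apply/dfun_lsubmx/dfun_id.
apply: (@dset_ext _ _ _ _ (fun z : 'rV_(k + 1) =>
  (0 <= u (lsubmx z) /\ z 0 (rshift k 0) = u (lsubmx z)) \/
  (u (lsubmx z) <= 0 /\ z 0 (rshift k 0) = - u (lsubmx z)))).
  move=> z; split; last by move=> [[u0 ->]|[u0 ->]]; [rewrite ger0_norm|rewrite ler0_norm].
  move=> ->; have [u0|u0] := leP 0 (u (lsubmx z)); [left|right].
    by rewrite ger0_norm.
  by rewrite ltr0_norm// (ltW u0).
apply: dset_or; apply: dset_and.
- by apply: dset_le => //; exact: dfunR_const.
- by apply: dset_eq => //; exact: dfunR_coord0.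
- by apply: dset_le => //; exact: dfunR_const.
- by apply: dset_eq; [exact: dfunR_coord0|exact: dfunR_opp].
Qed.

(** A substitute for a right derivative along [v] of value at least [c]. It involves no limit, and
    it is first-order, hence definable. *)
Definition slope_ge phi v c x :=
  exists d, 0 < d /\ forall s, 0 < s -> s < d -> c * s <= phi (x + s *: v) - phi x.

Lemma dset_slope_ge k phi v (c : 'rV[R]_k -> R) (x : 'rV[R]_k -> 'rV[R]_n) :
  dfunR D phi -> dfunR D c -> dfun D x ->
  dset D (fun z => slope_ge phi v (c z) (x z)).
Proof.
move=> dphi dc dx; apply: dset_exists; apply: dset_and.
  apply: dset_lt; first exact: dfunR_const.
  by apply/dfunR_coord/dfun_rsubmx/dfun_id.
have dt : dfunR D (fun z : 'rV_(k + 1 + 1) => rsubmx z 0 0).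
  by apply/dfunR_coord/dfun_rsubmx/dfun_id.
have dl : dfun D (fun z : 'rV[R]_(k + 1 + 1) => lsubmx (lsubmx z)).
  by apply/dfun_lsubmx/dfun_lsubmx/dfun_id.
have dxl := dfun_comp dl dx; have dcl := dfunR_comp dl dc.
apply: dset_forall; apply: dset_imp.
  by apply: dset_lt => //; exact: dfunR_const.
apply: dset_imp.
  by apply: dset_lt => //; apply/dfunR_coord/dfun_rsubmx/dfun_lsubmx/dfun_id.
apply: dset_le; first exact: dfunR_mul.
apply: dfunR_add; last by apply: dfunR_opp; exact: dfunR_comp dphi.
apply: dfunR_comp dphi; apply: dfun_add => //.
by apply: dfun_scale => //; exact: dfun_const.
Qed.

(** By tameness the inequality in [s] either holds or fails for all small [s > 0], so the negation
    of [slope_ge] is an inequality on a whole interval. *)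
Lemma slope_geVlt phi v c x : dfunR D phi -> ~ slope_ge phi v c x ->
  exists2 d, 0 < d & forall s, 0 < s -> s < d -> phi (x + s *: v) - phi x < c * s.
Proof.
move=> dphi nUp.
have : dset D (fun s : 'rV_1 => c * s 0 0 <= phi (x + s 0 0 *: v) - phi x).
  apply: dset_le.
    by apply: dfunR_mul; [exact: dfunR_const|exact: dfunR_coord0].
  apply: dfunR_add; last exact: dfunR_const.
  apply: dfunR_comp dphi; apply: dfun_add; first exact: dfun_const.
  by apply: dfun_scale; [exact: dfunR_coord0|exact: dfun_const].
move=> /(@dset_near_right _ _ (fun s => c * s <= phi (x + s *: v) - phi x) 0).
move=> [/near_rightP[d d0 H]|/near_rightP[d d0 H]].
  by exfalso; apply: nUp; exists d; split => // s s0 sd; apply: H; rewrite ?add0r.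
exists d => // s s0 sd; rewrite ltNge; apply/negP; apply: H => //.
by rewrite add0r.
Qed.

Lemma slope_ge_le phi v c c' x : c' <= c -> slope_ge phi v c x -> slope_ge phi v c' x.
Proof.
move=> cc [d [d0 H]]; exists d; split=> // s s0 sd; apply: le_trans (H _ s0 sd).
by rewrite ler_pM2r.
Qed.

Lemma line_continuous phi x v : continuous phi ->
  continuous (fun t : R => phi (x + t *: v)).
Proof.
move=> cphi t; apply: (@continuous_comp _ _ _ (fun t : R => x + t *: v) phi); last exact: cphi.
by apply: cvgD; [exact: cvg_cst|apply: cvgZr_tmp; exact: cvg_id].
Qed.

(** Mean value inequality: [dini_le] applied to [phi (x + t *: v) - c * t]. *)
Lemma slope_ge_segment phi v c x l : continuous phi -> 0 <= l ->
  (forall t, 0 <= t -> t < l -> slope_ge phi v c (x + t *: v)) ->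
  c * l <= phi (x + l *: v) - phi x.
Proof.
move=> cphi l0 H; pose h t := phi (x + t *: v) - c * t.
suff : h 0 <= h l by rewrite /h scale0r addr0; lra.
apply: dini_le => // t.
  move=> _ _; rewrite /h; apply: cvgB; first exact: line_continuous.
  by apply: cvgMl_tmp; exact: cvg_id.
move=> t0 tl; have [d [d0 Hd]] := H _ t0 tl.
apply/near_rightP; exists d => // s ts sd; rewrite /h.
have := Hd (s - t); rewrite -addrA -scalerDl addrC -[t + (s - t)]addrC subrK.
have [] : 0 < s - t /\ s - t < d by split; lra.
by move=> a b /(_ a b); rewrite addrC; lra.
Qed.

End Slopes.

(** * Generic smoothness *)

Section StrictPartial.
Context (R : realType) (D : omin_structure R) (n : nat).
Implicit Types (phi : 'rV[R]_n -> R) (x v : 'rV[R]_n).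

Lemma ball_segment x v y (r t s : R) : ball x r y -> ball x r (y + t *: v) ->
  0 <= s -> s <= t -> ball x r (y + s *: v).
Proof.
move=> [r0 xy] [_ xyt] s0 st; split => // i j.
have := xy i j; have := xyt i j.
rewrite -!ball_normE /= !mxE !ltr_norml => /andP[a b] /andP[c d].
have [t0|t0] := eqVneq t 0.
  have -> : s = 0 by apply/eqP; rewrite eq_le s0 -t0 st.
  by apply/andP; split; lra.
have tp : 0 < t by rewrite lt_neqAle eq_sym t0 (le_trans s0).
set l := s / t; have l0 : 0 <= l by rewrite divr_ge0// ltW.
have l1 : l <= 1 by rewrite ler_pdivrMr// mul1r.
have -> : s * v i j = l * (t * v i j) by rewrite /l mulrA divfK.
move: a b c d; set w := t * v i j; set xx := x i j; set yy := y i j => a b c d.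
have [l_eq0|ln0] := eqVneq l 0; first by rewrite l_eq0; apply/andP; split; lra.
have lp : 0 < l by rewrite lt_neqAle eq_sym ln0.
have l1' : 0 <= 1 - l by lra.
(* The bounds at the two ends, weighted by [l] and [1 - l]; with these products given, the rest is
   linear. *)
have P1 : 0 < l * (r - (xx - (yy + w))) by rewrite mulr_gt0//; lra.
have P2 : 0 < l * (r + (xx - (yy + w))) by rewrite mulr_gt0//; lra.
have P3 : 0 <= (1 - l) * (r - (xx - yy)) by rewrite mulr_ge0//; lra.
have P4 : 0 <= (1 - l) * (r + (xx - yy)) by rewrite mulr_ge0//; lra.
by apply/andP; split; lra.
Qed.

(** The base point [y] varies along with [t]. This uniformity is what later yields Fréchet
    differentiability and continuous partial derivatives. *)
Definition nearly_linear phi v e x := exists c d, 0 < d /\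
  forall y t, ball x d y -> ball x d (y + t *: v) ->
    `|phi (y + t *: v) - phi y - c * t| <= e * `|t|.

Lemma nearly_linear_le phi v e e' x : e <= e' ->
  nearly_linear phi v e x -> nearly_linear phi v e' x.
Proof.
move=> ee [c [d [d0 H]]]; exists c, d; split => // y t b1 b2.
by apply: le_trans (H _ _ b1 b2) _; rewrite ler_wpM2r.
Qed.

Lemma dset_nearly_linear k phi v (e : 'rV[R]_k -> R) (x : 'rV[R]_k -> 'rV[R]_n) :
  dfunR D phi -> dfunR D e -> dfun D x ->
  dset D (fun z => nearly_linear phi v (e z) (x z)).
Proof.
move=> dphi de dx.
apply: dset_exists; apply: dset_exists; apply: dset_and.
  apply: dset_lt; first exact: dfunR_const.
  by apply/dfunR_coord/dfun_rsubmx/dfun_id.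
apply: dset_forall_rV; apply: dset_forall.
have d4 := @dfun_id R D (k + 1 + 1 + n + 1).
have dt : dfunR D (fun z : 'rV_(k + 1 + 1 + n + 1) => rsubmx z 0 0).
  exact/dfunR_coord/dfun_rsubmx.
have dy := dfun_rsubmx (dfun_lsubmx d4).
have dl := dfun_lsubmx (dfun_lsubmx (dfun_lsubmx (dfun_lsubmx d4))).
have dxl := dfun_comp dl dx; have del := dfunR_comp dl de.
have dd := dfunR_coord 0 (dfun_rsubmx (dfun_lsubmx (dfun_lsubmx d4))).
have dc := dfunR_coord 0 (dfun_rsubmx (dfun_lsubmx (dfun_lsubmx (dfun_lsubmx d4)))).
have dyt := dfun_add dy (dfun_scale dt (@dfun_const R D _ _ v)).
apply: dset_imp; first exact: dset_ball.
apply: dset_imp; first exact: dset_ball.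
apply: dset_le; last by apply: dfunR_mul => //; exact: dfunR_norm.
apply: dfunR_norm; apply: dfunR_add; last by apply: dfunR_opp; exact: dfunR_mul.
by apply: dfunR_add; [exact: (dfunR_comp dyt dphi)|apply: dfunR_opp; exact: (dfunR_comp dy dphi)].
Qed.

(* [inl] stands for an infinite right derivative, [inr k] for one in
   [[k * e, (k + 1) * e]]. *)
Definition slope_class phi v e (k : bool + int) x :=
  match k with
  | inl true => forall c, slope_ge phi v c x
  | inl false => forall c, slope_ge (fun y => - phi y) v c x
  | inr k => slope_ge phi v (k%:~R * e) x /\
             slope_ge (fun y => - phi y) v (- ((k + 1)%:~R * e)) x
  end.

(** If no finite class contained [x], a lower bound [k * e] on the slope would improve to
    [(k + 1) * e], and so on without end. So either all lower bounds hold, or none does and the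
    slope is minus infinity. *)
Lemma slope_class_cover phi v (e : R) x : dfunR D phi -> 0 < e ->
  exists k, slope_class phi v e k x.
Proof.
move=> dphi e0.
have nUp k : ~ slope_ge phi v (k%:~R * e) x ->
    slope_ge (fun y => - phi y) v (- (k%:~R * e)) x.
  move=> /(slope_geVlt dphi)[d d0 H]; exists d; split=> // s s0 sd.
  by have := H _ s0 sd; lra.
have arch (c : R) : exists2 k : int, c <= k%:~R * e & 0 <= k.
  exists (Num.ceil `|c / e|); last by rewrite ceil_ge0 (lt_le_trans _ (normr_ge0 _))// ltrN10.
  by rewrite -ler_pdivrMr// (le_trans (ler_norm _))// ceil_ge.
have [allU|/existsNP[k1 nk1]] := pselect (forall k : int, slope_ge phi v (k%:~R * e) x).
  exists (inl true) => c; have [k ck _] := arch c.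
  exact: slope_ge_le (allU k).
have [[k0 k0P]|/forallNP noU] := pselect (exists k : int, slope_ge phi v (k%:~R * e) x); last first.
  exists (inl false) => c; have [k ck _] := arch c.
  have := nUp _ (noU (- k)); rewrite mulrNz mulNr opprK.
  exact: slope_ge_le.
apply: contrapT => /forallNP noK.
have step k : slope_ge phi v (k%:~R * e) x -> slope_ge phi v ((k + 1)%:~R * e) x.
  by move=> Uk; apply: contrapT => nUk; apply: (noK (inr k)); split => //; exact: nUp.
have all m : slope_ge phi v ((k0 + m%:Z)%:~R * e) x.
  by elim: m => [|m IH]; [rewrite addr0|rewrite -addn1 PoszD addrA; exact: step].
apply: nk1; have [k k1k] : exists m : nat, k1 <= k0 + m%:Z.
  exists `|k1 - k0|%N; rewrite -lerBlDl; exact: ler_norm.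
apply: slope_ge_le (all k).
by rewrite ler_pM2r// ler_int.
Qed.

Lemma open_ball_sub (U : set 'rV[R]_n) u : open U -> U u ->
  exists2 r : R, 0 < r & ball u r `<=` U.
Proof.
by move=> oU Uu; have /nbhs_ballP[r] := open_nbhs_nbhs (conj oU Uu); exists r.
Qed.

(** The countably many slope classes cover [B], so one of them contains an open set. An infinite
    slope on an open set contradicts the mean value inequality; a finite class confines all
    increments between slopes [k * e] and [(k + 1) * e]. *)
Lemma nearly_linear_dense phi v (e : R) (B : set 'rV[R]_n) : dfunR D phi ->
  continuous phi -> 0 < e -> open B -> B !=set0 ->
  exists2 x, B x & nearly_linear phi v e x.
Proof.
move=> dphi cphi e0 oB B0.
have dN := dfunR_opp dphi.
have cN : continuous (fun y => - phi y) by move=> x; exact: (continuousN (@cphi x)).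
have [||k [U [oU [u Uu] UB UX]]] := @dset_cover R D n _ (slope_class phi v e) B _ oB B0.
- case=> [[]|k].
  + apply: dset_forall; apply: dset_slope_ge => //.
      by apply/dfunR_coord/dfun_rsubmx/dfun_id.
    by apply/dfun_lsubmx/dfun_id.
  + apply: dset_forall; apply: dset_slope_ge => //.
      by apply/dfunR_coord/dfun_rsubmx/dfun_id.
    by apply/dfun_lsubmx/dfun_id.
  + apply: dset_and; apply: dset_slope_ge => //; solve [exact: dfunR_const|exact: dfun_id].
- by move=> x _; exact: slope_class_cover.
have [r r0 rU] := open_ball_sub oU Uu.
have lineU : exists2 t : R, 0 < t & forall s, 0 <= s -> s <= t -> U (u + s *: v).
  have : (fun s : R => u + s *: v) s @[s --> (0 : R)] --> u + 0 *: v.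
    by apply: cvgD; [exact: cvg_cst|apply: cvgZr_tmp; exact: cvg_id].
  rewrite scale0r addr0 => /(_ U (open_nbhs_nbhs (conj oU Uu)))/nbhs_ballP[d /= d0 H].
  exists (d / 2); first by lra.
  by move=> s s0 sd; apply: H; rewrite -ball_normE /= ltr_norml; apply/andP; split; lra.
have infF psi : continuous psi -> ~ (forall x, U x -> forall c, slope_ge psi v c x).
  move=> cpsi H; have [t t0 tU] := lineU.
  (* With this slope the mean value inequality would make the increment of [psi] exceed itself by
     1. *)
  have := @slope_ge_segment _ _ psi v ((psi (u + t *: v) - psi u + 1) / t) u t cpsi (ltW t0).
  rewrite divfK ?gt_eqF// => H1.
  suff : psi (u + t *: v) - psi u + 1 <= psi (u + t *: v) - psi u by lra.
  by apply: H1 => s s0 st; apply: H; apply: tU => //; exact: ltW.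
case: k UX => [[]|k] /= UX; [by have := infF _ cphi UX|by have := infF _ cN UX|].
exists u; first exact: UB.
exists (k%:~R * e), r; split => // y t.
have pos z s : 0 <= s -> ball u r z -> ball u r (z + s *: v) ->
    k%:~R * e * s <= phi (z + s *: v) - phi z <= (k%:~R + 1) * e * s.
  move=> s0 bz bzs.
  have Uz s' : 0 <= s' -> s' < s -> U (z + s' *: v).
    by move=> s'0 s's; apply: rU; apply: ball_segment bz bzs s'0 (ltW s's).
  apply/andP; split.
    apply: slope_ge_segment => // s' s'0 s's; by have [] := UX _ (Uz _ s'0 s's).
  have H : - ((k + 1)%:~R * e) * s <= - phi (z + s *: v) - - phi z.
    apply: (@slope_ge_segment _ _ (fun y => - phi y) v _ z s cN s0) => s' s'0 s's.
    by have [] := UX _ (Uz _ s'0 s's).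
  by move: H; rewrite intrD; lra.
move=> by_ byt; have [t0|t0] := leP 0 t.
  have /andP[] := pos _ _ t0 by_ byt; set c := k%:~R * e.
  by rewrite mulrDl mul1r mulrDl -/c (ger0_norm t0) ler_norml => a b; apply/andP; split; nra.
(* For negative [t] the segment is traversed from its other end. *)
have := pos (y + t *: v) (- t); rewrite scaleNr addrK oppr_ge0 (ltW t0) => /(_ isT byt by_).
set c := k%:~R * e; rewrite mulrDl mul1r mulrDl -/c (ltr0_norm t0) ler_norml => /andP[a b].
by apply/andP; split; nra.
Qed.

(** Points are sorted by the first kind of failure: near linearity fails at some [1 / (k + 1)], or
    it holds for every [e]. Failure on an open set is excluded by [nearly_linear_dense]. *)
Lemma strict_partial_dense phi v (B : set 'rV[R]_n) : dfunR D phi ->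
  continuous phi -> open B -> B !=set0 ->
  exists U : set 'rV[R]_n, [/\ open U, U !=set0, U `<=` B &
    forall x, U x -> forall e, 0 < e -> nearly_linear phi v e x].
Proof.
move=> dphi cphi oB B0.
pose X (k : option nat) x := if k is Some k then ~ nearly_linear phi v k.+1%:R^-1 x
  else forall e, 0 < e -> nearly_linear phi v e x.
have [||[k|] [U [oU U0 UB UX]]] := @dset_cover R D n _ X B _ oB B0.
- case=> [k|] /=.
    by apply: dset_not; apply: dset_nearly_linear => //; [exact: dfunR_const|exact: dfun_id].
  apply: dset_forall; apply: dset_imp.
    apply: dset_lt; first exact: dfunR_const.
    by apply/dfunR_coord/dfun_rsubmx/dfun_id.
  apply: dset_nearly_linear => //; last by apply/dfun_lsubmx/dfun_id.
  by apply/dfunR_coord/dfun_rsubmx/dfun_id.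
- move=> x _; have [S|] := pselect (forall e, 0 < e -> nearly_linear phi v e x).
    by exists None.
  move=> /existsNP[e /not_implyP[e0 nL]].
  exists (Some (Num.truncn e^-1)) => /= L; apply: nL; apply: nearly_linear_le L.
  by rewrite invf_ple ?posrE// ltW// truncnS_gt.
- have [x Ux] := @nearly_linear_dense phi v k.+1%:R^-1 U dphi cphi ltac:(by rewrite invr_gt0) oU U0.
  by move/(UX _ Ux).
- by exists U.
Qed.

End StrictPartial.

(** * From strict directional derivatives to Fréchet estimates *)

Section ContinuouslyDifferentiable.
Context (R : realType) (n : nat).
Implicit Types (phi : 'rV[R]_n -> R) (x v : 'rV[R]_n).

Lemma coord_le_norm m k (h : 'M[R]_(m, k)) i j : `|h i j| <= `|h|.
Proof.
rewrite [leRHS]/Num.Def.normr /= mx_normrE; apply/bigmax_geP; right => /=.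
by exists (i, j).
Qed.

Lemma ball_coordP m k (x y : 'M[R]_(m, k)) (r : R) : 0 < r ->
  ball x r y <-> forall i j, `|x i j - y i j| < r.
Proof.
move=> r0; split=> [[_ H] i j|H]; first by have := H i j; rewrite -ball_normE.
by split=> // i j; rewrite -ball_normE /=.
Qed.

Definition strict_deriv phi v x g := forall e, 0 < e -> exists2 d, 0 < d &
  forall y t, ball x d y -> ball x d (y + t *: v) ->
    `|phi (y + t *: v) - phi y - g * t| <= e * `|t|.

Lemma near0_line x v (r : R) : 0 < r ->
  \forall t \near (0 : R)^'+, ball x r (x + t *: v).
Proof.
move=> r0.
have : (fun s : R => x + s *: v) s @[s --> (0 : R)] --> x + 0 *: v.
  by apply: cvgD; [exact: cvg_cst|apply: cvgZr_tmp; exact: cvg_id].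
rewrite scale0r addr0 => /(_ _ (nbhsx_ballx _ _ r0))/nbhs_ballP[d /= d0 H].
apply/near_rightP; exists d => // t t0; rewrite add0r => td; apply: H.
by rewrite -ball_normE /= sub0r normrN gtr0_norm.
Qed.

(** Both estimates are compared on one short segment issued from [y]. With [y = x] this serves for
    the uniqueness of the slope, and with [y] near [x] for the continuity of the derivative. *)
Lemma slope_close phi v x y (c c' e e' d d' : R) : 0 < d' -> ball x d y ->
  (forall z t, ball x d z -> ball x d (z + t *: v) ->
    `|phi (z + t *: v) - phi z - c * t| <= e * `|t|) ->
  (forall z t, ball y d' z -> ball y d' (z + t *: v) ->
    `|phi (z + t *: v) - phi z - c' * t| <= e' * `|t|) ->
  `|c - c'| <= e + e'.
Proof.
move=> d'0 xy H H'.
have [r r0 rd] := open_ball_sub (@ball_open _ _ x d) xy.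
have : \forall t \near (0 : R)^'+, 0 < t /\ ball y d' (y + t *: v) /\ ball y r (y + t *: v).
  near=> t; split; first by near: t; exact: nbhs_right_gt.
  by split; near: t; exact: near0_line.
move=> /near_rightP[s s0 Hs].
have [] := Hs (s / 2); [by lra|by lra|].
set t := s / 2 => t0 [b1 b2].
have := H y t xy (rd _ b2); have := H' y t (ballxx _ d'0) b1.
rewrite !(gtr0_norm t0) !ler_norml => /andP[p1 p2] /andP[p3 p4].
apply/andP; split; rewrite -(ler_pM2r t0); lra.
Unshelve. all: by end_near. Qed.

(** The intervals [[c - e, c + e]] of admissible slopes meet pairwise by [slope_close], so the
    supremum of their left ends lies in all of them; it is the derivative. *)
Lemma nearly_linear_strict_deriv phi v x :
  (forall e, 0 < e -> nearly_linear phi v e x) -> exists g, strict_deriv phi v x g.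
Proof.
move=> H; pose valid c e := exists2 d, 0 < d &
  forall y t, ball x d y -> ball x d (y + t *: v) ->
    `|phi (y + t *: v) - phi y - c * t| <= e * `|t|.
have V e : 0 < e -> exists c, valid c e.
  by move=> /H[c [d [d0 Hd]]]; exists c, d.
have cmp c e c' e' : valid c e -> valid c' e' -> c - e <= c' + e'.
  move=> [d d0 Hd] [d' d'0 Hd'].
  have := slope_close d'0 (ballxx x d0) Hd Hd'.
  by rewrite ler_norml => /andP[]; lra.
pose S : set R := [set c | exists c0 e, valid c0 e /\ c = c0 - e].
have [c1 v1] := V 1 ltr01.
have hS : has_sup S.
  split; first by exists (c1 - 1), c1, 1.
  by exists (c1 + 1) => _ [c [e [Vc ->]]]; exact: cmp.
exists (sup S) => e e0; have [c [d d0 Hd]] := V (e / 2) ltac:(lra).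
exists d => // y t b1 b2.
have lo : c - e / 2 <= sup S.
  by apply: sup_upper_bound => //; exists c, (e / 2); split=> //; exists d.
have hi : sup S <= c + e / 2.
  apply: ge_sup; first by exists (c1 - 1), c1, 1.
  by move=> _ [c' [e' [Vc ->]]]; apply: cmp => //; exists d.
have := Hd y t b1 b2; set A := phi (y + t *: v) - phi y.
have -> : A - sup S * t = (A - c * t) + (c - sup S) * t by ring.
move=> Ac; rewrite (le_trans (ler_normD _ _))// normrM.
have : `|c - sup S| * `|t| <= e / 2 * `|t|.
  by rewrite ler_wpM2r// ler_norml; apply/andP; split; lra.
lra.
Qed.

(** The coordinates of [h] are switched on one at a time and the increments telescope. Each
    increment starts from an intermediate point, which strictness allows. *)
Lemma strict_deriv_frechet phi x (g : 'I_n -> R) :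
  (forall i, strict_deriv phi (delta_mx 0 i) x (g i)) ->
  forall e, 0 < e -> exists2 d, 0 < d & forall h : 'rV[R]_n, `|h| < d ->
    `|phi (x + h) - phi x - \sum_i h 0 i * g i| <= e * `|h|.
Proof.
(* The [n] coordinates share the error; [n.+1] keeps the divisor nonzero when [n = 0]. *)
move=> H e e0; pose e' := e / n.+1%:R.
have e'0 : 0 < e' by rewrite divr_gt0.
have : \forall d \near (0 : R)^'+, forall i y t,
    ball x d y -> ball x d (y + t *: delta_mx 0 i) ->
    `|phi (y + t *: delta_mx 0 i) - phi y - g i * t| <= e' * `|t|.
  apply: filter_forall => i; have [d d0 Hd] := H i _ e'0.
  apply/near_rightP; exists d => // r r0; rewrite add0r => rd y t b1 b2.
  by apply: Hd; [apply: le_ball b1|apply: le_ball b2]; exact: ltW.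
move=> /near_rightP[d d0 Hd]; exists (d / 2); first by lra.
move=> h hd; pose hk k : 'rV[R]_n := \row_j (if (j < k)%N then h 0 j else 0).
have b k : ball x (d / 2) (x + hk k).
  apply/ball_coordP; first by lra.
  move=> i j; rewrite ord1 !mxE opprD addrA subrr sub0r normrN.
  case: ifP => _; last by rewrite normr0; lra.
  exact: le_lt_trans (coord_le_norm _ _ _) hd.
have hkS k (kn : (k < n)%N) : hk k.+1 = hk k + h 0 (Ordinal kn) *: delta_mx 0 (Ordinal kn).
  apply/rowP => j; rewrite !mxE eqxx /= ltnS leq_eqVlt.
  have [->|jk] := eqVneq j (Ordinal kn); first by rewrite eqxx ltnn /= mulr1 add0r.
  rewrite mulr0 addr0; suff -> : (val j == k) = false by [].
  by apply: contra_neqF jk => /eqP jk; exact/val_inj.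
have tel k : (k <= n)%N ->
  `|phi (x + hk k) - phi x - \sum_(i < n | (i < k)%N) h 0 i * g i| <= k%:R * (e' * `|h|).
  elim: k => [|k IH] kn.
    rewrite big_pred0// mul0r.
    suff -> : hk 0%N = 0 by rewrite addr0 !subrr normr0.
    by apply/rowP => j; rewrite !mxE.
  rewrite (bigD1 (Ordinal kn))//= (eq_bigl (fun i : 'I_n => (i < k)%N)); last first.
    move=> i; rewrite ltnS ltn_neqAle andbC; congr (~~ _ && _).
  set S := \sum_(i < n | _) _.
  have := Hd (d / 2) ltac:(lra) ltac:(lra) (Ordinal kn) (x + hk k) (h 0 (Ordinal kn)) (b k).
  rewrite -addrA -hkS => /(_ (b k.+1)); set i := Ordinal kn => Hi.
  have := IH (ltnW kn); rewrite -/S => IHk.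
  have -> : phi (x + hk k.+1) - phi x - (h 0 i * g i + S) =
    (phi (x + hk k) - phi x - S) + (phi (x + hk k.+1) - phi (x + hk k) - g i * h 0 i) by ring.
  rewrite (le_trans (ler_normD _ _))// mulrSr mulrDl mul1r lerD//.
  by rewrite (le_trans Hi)// ler_wpM2l ?coord_le_norm// ltW.
have := tel n (leqnn n).
have -> : hk n = h by apply/rowP => j; rewrite mxE ltn_ord.
rewrite (eq_bigl predT) => [H1|i]; last by rewrite ltn_ord.
rewrite (le_trans H1)// mulrA ler_wpM2r// /e' mulrCA ger_pMr//.
by rewrite ler_pdivrMr// mul1r ler_nat.
Qed.

End ContinuouslyDifferentiable.

Lemma cvg_mx_coord (R : realType) m k (T : Type) (F : set_system T) (FF : Filter F)
    (g : T -> 'M[R]_(m, k)) (l : 'M[R]_(m, k)) :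
  (forall i j, (fun x => g x i j) x @[x --> F] --> l i j) -> g x @[x --> F] --> l.
Proof.
move=> H; apply/cvgrPdist_lt => e e0.
have : \forall x \near F, forall ij : 'I_m * 'I_k, `|l ij.1 ij.2 - g x ij.1 ij.2| < e.
  by apply: filter_forall => -[i j] /=; have /cvgrPdist_lt/(_ _ e0) := H i j.
apply: filterS => x Hx.
have : ball l e (g x) by apply/ball_coordP => // i j; exact: (Hx (i, j)).
by rewrite -ball_normE.
Qed.

(** * Density of the points of continuous differentiability *)

Section C1Dense.
Context (R : realType) (D : omin_structure R) (n : nat).
Context (f : 'rV[R]_n -> 'rV[R]_n).

Lemma jacobian_strict_deriv (x : 'rV[R]_n) (A : 'M[R]_n) :
  (forall i j, strict_deriv (fun y => f y 0 j) (delta_mx 0 i) x (A i j)) ->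
  differentiable f x /\ 'J f x = A.
Proof.
move=> H.
have lin : linear (fun h : 'rV[R]_n => h *m A).
  by move=> a u v; rewrite mulmxDl scalemxAl.
pose dA : {linear 'rV[R]_n -> 'rV[R]_n} := mulmxr A.
have cA : continuous dA.
  move=> h; apply: (@cvg_mx_coord _ _ _ _ (nbhs h)) => i j.
  have -> : (fun w : 'rV[R]_n => dA w i j) = fun w => \sum_k w i k * A k j.
    by apply/funext => w; rewrite mxE.
  rewrite mxE; apply: cvg_big => [|k _]; first exact: add_continuous.
  by apply: cvgMr_tmp; exact: coord_continuous.
have dfA : f \o shift x = cst (f x) + dA +o_ 0 id.
  apply/eqaddoP => e e0.
  have : \forall d \near (0 : R)^'+, forall j (h : 'rV[R]_n), `|h| < d ->
      `|f (x + h) 0 j - f x 0 j - \sum_i h 0 i * A i j| <= e * `|h|.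
    apply: filter_forall => j.
    have [d d0 Hd] := strict_deriv_frechet (fun i => H i j) e0.
    apply/near_rightP; exists d => // r r0; rewrite add0r => rd h hr; apply: Hd.
    exact: lt_trans rd.
  move=> /near_rightP[d d0 Hd]; apply/nbhs_ballP; exists (d / 2); first by rewrite /=; lra.
  move=> h; rewrite -ball_normE /= sub0r normrN => hd.
  have {}Hd := Hd (d / 2) ltac:(lra) ltac:(lra).
  rewrite [leLHS]/Num.Def.normr /= mx_normrE; apply/bigmax_leP; split.
    by rewrite mulr_ge0// ltW.
  move=> [i j] _ /=; rewrite ord1; have := Hd j h hd.
  by congr (`|_| <= _); rewrite !fctE /= /shift /= !mxE addrC [h + x]addrC; ring.
have dE := diff_unique cA dfA.
split; first by apply/diff_locallyP; rewrite dE.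
apply/matrixP => i j; rewrite /jacobian mxE dE /=.
by rewrite -rowE mxE.
Qed.

(** Strictness at [y] controls the increments around every nearby [z], so [slope_close] bounds the
    difference of the partial derivatives by [e / 3 + e / 3]. *)
Lemma C1_near_strict_deriv (U : set 'rV[R]_n) : open U ->
  (forall x, U x -> forall i j, exists g,
    strict_deriv (fun y => f y 0 j) (delta_mx 0 i) x g) ->
  forall x, U x -> C1_near f x.
Proof.
move=> oU H x Ux.
have JS y : U y -> differentiable f y /\
    forall i j, strict_deriv (fun y => f y 0 j) (delta_mx 0 i) y ('J f y i j).
  move=> Uy.
  have [A HA] : exists A : 'I_n -> 'I_n -> R, forall i j,
      strict_deriv (fun y => f y 0 j) (delta_mx 0 i) y (A i j).
    have /choice[A HA] : forall ij : 'I_n * 'I_n, exists g,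
        strict_deriv (fun y => f y 0 ij.2) (delta_mx 0 ij.1) y g.
      by move=> [i j]; exact: H.
    by exists (fun i j => A (i, j)) => i j; exact: HA (i, j).
  have HB i j : strict_deriv (fun y => f y 0 j) (delta_mx 0 i) y ((\matrix_(i, j) A i j) i j).
    by rewrite mxE; exact: HA.
  have [df JE] := jacobian_strict_deriv HB; split=> // i j; rewrite JE; exact: HB.
have := open_nbhs_nbhs (conj oU Ux); apply: filterS => y Uy.
split; first by have [] := JS y Uy.
have [_ Sy] := JS y Uy.
apply: (@cvg_mx_coord _ _ _ _ (nbhs y)) => i j; apply/cvgrPdist_lt => e e0.
have [d d0 Hd] := Sy i j (e / 3) ltac:(lra).
have : \forall z \near y, ball y d z by exact: nbhsx_ballx.
have := open_nbhs_nbhs (conj oU Uy); apply: filterS2 => z Uz yz.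
have [d' d'0 Hd'] := (JS z Uz).2 i j (e / 3) ltac:(lra).
by have := slope_close d'0 yz Hd Hd'; lra.
Qed.

(** The open set is shrunk once for each pair of a variable and a component of [f]. *)
Lemma C1_dense (B : set 'rV[R]_n) : dfun D f -> continuous f ->
  open B -> B !=set0 -> exists2 x, B x & C1_near f x.
Proof.
move=> df cf oB B0.
have cfj j : continuous (fun y => f y 0 j).
  move=> y; apply: (@continuous_comp _ _ _ f (fun w : 'rV[R]_n => w 0 j)).
    exact: cf.
  exact: coord_continuous.
have [U [oU [u Uu] UB H]] : exists U : set 'rV[R]_n, [/\ open U, U !=set0, U `<=` B &
   forall ij, ij \in enum {: 'I_n * 'I_n} -> forall x, U x -> forall e, 0 < e ->
     nearly_linear (fun y => f y 0 ij.2) (delta_mx 0 ij.1) e x].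
  elim: (enum _) => [|[i j] s [V [oV V0 VB HV]]]; first by exists B; split=> // ij.
  have [U [oU U0 UV HU]] := strict_partial_dense (delta_mx 0 i) (df j) (cfj j) oV V0.
  exists U; split=> //; first exact: subset_trans VB.
  move=> ij; rewrite inE => /predU1P[->|ijs] x Ux; first exact: HU.
  by apply: HV => //; exact: UV.
exists u; first exact: UB.
apply: (C1_near_strict_deriv oU) => // x Ux i j.
apply: nearly_linear_strict_deriv; apply: (H (i, j)) => //.
by rewrite mem_enum.
Qed.

End C1Dense.

(** * The expansion estimate *)

Section Euclidean.
Context (R : realType) (n : nat).
Implicit Types (u v w x y : 'rV[R]_n).

Definition dot u v : R := \sum_i u 0 i * v 0 i.

Lemma dotC u v : dot u v = dot v u.
Proof. by apply: eq_bigr => i _; rewrite mulrC. Qed.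

Lemma dotDr u v w : dot u (v + w) = dot u v + dot u w.
Proof. by rewrite -big_split; apply: eq_bigr => i _; rewrite mxE mulrDr. Qed.

Lemma dotZr u v a : dot u (a *: v) = a * dot u v.
Proof. by rewrite mulr_sumr; apply: eq_bigr => i _; rewrite mxE mulrCA. Qed.

Lemma dotNr u v : dot u (- v) = - dot u v.
Proof. by rewrite -scaleN1r dotZr mulN1r. Qed.

Lemma dotBr u v w : dot u (v - w) = dot u v - dot u w.
Proof. by rewrite dotDr dotNr. Qed.

Lemma dotDl u v w : dot (u + v) w = dot u w + dot v w.
Proof. by rewrite ![dot _ w]dotC dotDr. Qed.

Lemma dotZl u v a : dot (a *: u) v = a * dot u v.
Proof. by rewrite ![dot _ v]dotC dotZr. Qed.

Lemma dot_ge0 u : 0 <= dot u u.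
Proof. by apply: sumr_ge0 => i _; rewrite -expr2 sqr_ge0. Qed.

Lemma enorm_dot u : enorm u = Num.sqrt (dot u u).
Proof. by congr Num.sqrt; apply: eq_bigr => i _; rewrite expr2. Qed.

Lemma sqr_enorm u : enorm u ^+ 2 = dot u u.
Proof. by rewrite enorm_dot sqr_sqrtr// dot_ge0. Qed.

Lemma enorm_ge0 u : 0 <= enorm u.
Proof. exact: sqrtr_ge0. Qed.

Lemma enormZ a u : enorm (a *: u) = `|a| * enorm u.
Proof. by rewrite !enorm_dot dotZl dotZr mulrA -expr2 sqrtrM ?sqr_ge0// sqrtr_sqr. Qed.

Lemma enorm0 : enorm (0 : 'rV[R]_n) = 0.
Proof. by rewrite -(scale0r 0) enormZ normr0 mul0r. Qed.

Lemma enormN u : enorm (- u) = enorm u.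
Proof. by rewrite -scaleN1r enormZ normrN normr1 mul1r. Qed.

Lemma enormB u v : enorm (u - v) = enorm (v - u).
Proof. by rewrite -enormN opprB. Qed.

Lemma coord_le_enorm u i : `|u 0 i| <= enorm u.
Proof.
rewrite -(ler_pXn2r (ltn0Sn 1)) ?nnegrE ?enorm_ge0// sqr_enorm real_normK ?num_real//.
rewrite /dot (bigD1 i)//= -expr2 lerDl; apply: sumr_ge0 => j _.
by rewrite -expr2 sqr_ge0.
Qed.

Lemma enorm_eq0 u : enorm u = 0 -> u = 0.
Proof.
move=> u0; apply/rowP => i; have := coord_le_enorm u i.
by rewrite u0 normr_le0 mxE => /eqP.
Qed.

Lemma norm_le_enorm u : `|u| <= enorm u.
Proof.
rewrite [leLHS]/Num.Def.normr /= mx_normrE; apply/bigmax_leP; split.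
  exact: enorm_ge0.
by move=> [i j] _; rewrite ord1; exact: coord_le_enorm.
Qed.

(** Cauchy-Schwarz, from the nonnegative square of [dot v v *: u - dot u v *: v]. *)
Lemma dot_le_enorm u v : dot u v <= enorm u * enorm v.
Proof.
have [v0|v0] := eqVneq (enorm v) 0.
  by rewrite (enorm_eq0 v0) enorm0 mulr0 -(scale0r 0) dotZr mul0r.
have vp : 0 < enorm v by rewrite lt_neqAle eq_sym v0 enorm_ge0.
have vv : 0 < dot v v by rewrite -sqr_enorm exprn_gt0.
have := dot_ge0 (dot v v *: u - dot u v *: v).
rewrite dotBr !dotDl -!scaleNr !dotZl !dotZr [dot v u]dotC => H.
have {}H : 0 <= dot v v * (dot u u * dot v v - dot u v ^+ 2) by move: H; lra.
rewrite pmulr_rge0// -!sqr_enorm -exprMn subr_ge0 in H.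
rewrite (le_trans (ler_norm _))// -(ler_pXn2r (ltn0Sn 1)) ?nnegrE ?mulr_ge0 ?enorm_ge0//.
by rewrite real_normK ?num_real.
Qed.

Lemma enormD u v : enorm (u + v) <= enorm u + enorm v.
Proof.
rewrite -(ler_pXn2r (ltn0Sn 1)) ?nnegrE ?addr_ge0 ?enorm_ge0//.
rewrite sqr_enorm dotDl !dotDr [dot v u]dotC.
by have := dot_le_enorm u v; rewrite sqrrD !sqr_enorm; lra.
Qed.

Lemma enorm_le_norm u : enorm u <= n%:R * `|u|.
Proof.
have -> : n%:R * `|u| = \sum_(i < n) `|u| by rewrite sumr_const card_ord mulr_natl.
have {1}-> : u = \sum_i u 0 i *: delta_mx 0 i by exact: row_sum_delta.
have H (s : seq 'I_n) : enorm (\sum_(i <- s) u 0 i *: delta_mx 0 i) <= \sum_(i <- s) `|u|.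
  elim: s => [|i s IH]; first by rewrite !big_nil enorm0.
  rewrite !big_cons (le_trans (enormD _ _))// lerD// enormZ.
  have -> : enorm (delta_mx 0 i : 'rV[R]_n) = 1.
    rewrite enorm_dot /dot (bigD1 i)//= big1 => [|j ji].
      by rewrite mxE !eqxx mulr1 addr0 sqrtr1.
    by rewrite mxE (negbTE ji) andbF mulr0.
  by rewrite mulr1 coord_le_norm.
exact: H.
Qed.

Lemma enorm_dist u v : `|enorm u - enorm v| <= enorm (u - v).
Proof.
rewrite ler_norml; apply/andP; split.
  by have := enormD (v - u) u; rewrite subrK enormB; lra.
by have := enormD (u - v) v; rewrite subrK; lra.
Qed.

Lemma enorm_continuous : continuous (@enorm R n).
Proof.
move=> u; apply/(@cvgrPdist_lt _ _ _ (nbhs u)) => e e0.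
have n0 : (0 : R) < n.+1%:R by rewrite ltr0n.
have en0 : 0 < e / n.+1%:R by rewrite divr_gt0.
have := nbhsx_ballx u _ en0.
apply: (@filterS _ (nbhs u)) => w; rewrite -ball_normE /= ltr_pdivlMr// mulrC => uw.
rewrite (le_lt_trans (enorm_dist _ _))// (le_lt_trans (enorm_le_norm _))//.
by rewrite (le_lt_trans _ uw)// ler_wpM2r// ler_nat.
Qed.

Lemma eball_open x r : open (@eball R n x r).
Proof.
have -> : eball x r = (fun y => enorm (y - x)) @^-1` [set t | t < r] by [].
apply: open_comp; last exact: open_lt.
move=> y _.
apply: (@continuous_comp _ _ _ (fun y => y - x) (@enorm R n)); last exact: enorm_continuous.
by apply: (@cvgB _ _ _ (nbhs y) _ id (cst x)); [exact: (@cvg_id _ (nbhs y))|exact: cvg_cst].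
Qed.

Lemma dot_continuous w : continuous (dot w).
Proof.
move=> u; apply: (@cvg_big _ _ _ _ _ _ _ (nbhs u)) => [|k _]; first exact: add_continuous.
by apply: (@cvgMl_tmp _ _ (nbhs u)); exact: coord_continuous.
Qed.

(* [w] is the normalisation of the point of the closure of [C] nearest to 0. *)
Lemma convex_separation (C : set 'rV[R]_n) m : C !=set0 ->
  (forall a b l, C a -> C b -> 0 <= l -> l <= 1 -> C ((1 - l) *: a + l *: b)) ->
  0 < m -> (forall c, C c -> m <= enorm c) ->
  exists2 w, enorm w = 1 & forall c, C c -> m <= dot w c.
Proof.
move=> [c0 Cc0] Cconv m0 Cm.
(* The closure is cut by the ball through [c0] to be compact, so that a point nearest to 0
   exists. *)
pose K := closure C `&` [set x | enorm x <= enorm c0].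
have cl_le (A : set R) : closed A -> closed ((@enorm R n) @^-1` A).
  by move=> cA; apply: (preimage_closed _ cA) => x _; exact: enorm_continuous.
have cK : closed K.
  apply: closedI; first exact: closed_closure.
  by apply: (cl_le [set t | t <= enorm c0]); exact: closed_le.
have bK : bounded_set K.
  exists (enorm c0); split; first exact: num_real.
  by move=> M cM x [_ /= xc]; rewrite (le_trans (norm_le_enorm _))// (le_trans xc)// ltW.
have K0 : K !=set0 by exists c0; split; [exact: subset_closure|rewrite /=].
have cE : {within K, continuous (@enorm R n)}.
  by apply: continuous_subspaceT; exact: enorm_continuous.
have [p pK pmin] := EVT_min_rV K0 (bounded_closed_compact bK cK) cE.
have [clp _] := set_mem pK.
have pm c : closure C c -> enorm p <= enorm c.
  move=> clc; have [cc|cc] := leP (enorm c) (enorm c0).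
    by apply: pmin; apply/mem_set.
  rewrite (le_trans _ (ltW cc))//; apply: pmin; apply/mem_set.
  by split; [exact: subset_closure|rewrite /=].
have mp : m <= enorm p.
  have : closure C `<=` (@enorm R n) @^-1` [set t | m <= t].
    rewrite [X in X `<=` _]closureE; apply: smallest_sub; first by apply: cl_le; exact: closed_ge.
    by move=> c /Cm.
  by apply.
have p0 : 0 < enorm p by exact: lt_le_trans mp.
exists ((enorm p)^-1 *: p).
  by rewrite enormZ gtr0_norm ?invr_gt0// mulVf// gt_eqF.
move=> c Cc; rewrite dotZl.
suff H : enorm p ^+ 2 <= dot p c.
  rewrite (le_trans mp)// mulrC ler_pdivlMr//; by rewrite expr2 in H.
have conv l : 0 <= l -> l <= 1 -> closure C ((1 - l) *: p + l *: c).
  move=> l0 l1.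
  pose g z : 'rV[R]_n := (1 - l) *: z + l *: c.
  have gc : continuous g.
    move=> z; apply: (@cvgD _ _ _ (nbhs z)); last exact: cvg_cst.
    by apply: (@cvgZl_tmp _ _ _ (nbhs z) _ _ id); exact: (@cvg_id _ (nbhs z)).
  have : closure C `<=` g @^-1` closure C.
    rewrite [X in X `<=` _]closureE; apply: smallest_sub.
      exact: (preimage_closed (in1W gc) (@closed_closure _ C)).
    by move=> z Cz; apply: subset_closure; exact: Cconv.
  exact.
(* First-order condition at the nearest point [p]: its norm is at most that of [p + l *: (c - p)];
   expand the squares and divide by [l]. *)
have key l : 0 < l -> l <= 1 -> - (l * dot (c - p) (c - p)) <= 2 * dot p (c - p).
  move=> l0 l1; have := pm _ (conv l (ltW l0) l1).
  rewrite -(ler_pXn2r (ltn0Sn 1)) ?nnegrE ?enorm_ge0// !sqr_enorm.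
  have -> : (1 - l) *: p + l *: c = p + l *: (c - p).
    by rewrite scalerBl scalerBr scale1r addrAC addrA.
  move: (c - p) => z; rewrite dotDl !dotDr !dotZl !dotZr [dot z p]dotC => H.
  by rewrite -(ler_pM2l l0); move: H; lra.
rewrite sqr_enorm leNgt; apply/negP => Hlt.
have d0 : dot p (c - p) < 0 by rewrite dotBr; lra.
set q := dot (c - p) (c - p) in key.
have q0 : 0 <= q by exact: dot_ge0.
set d := dot p (c - p) in key d0.
(* Chosen so that [l * q <= - d < - 2 * d], against [key]; the [+ 1] allows [q = 0]. *)
pose l := Num.min 1 (- d / (q + 1)).
have q1 : 0 < q + 1 by lra.
have l0 : 0 < l by rewrite lt_min ltr01 divr_gt0//; lra.
have l1 : l <= 1 by rewrite ge_min lexx.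
have l2 : l * (q + 1) <= - d by rewrite -ler_pdivlMr// ge_min lexx orbT.
have := key l l0 l1; nra.
Qed.

End Euclidean.

(** * From the convex hull of the Jacobians to expansion on a ball *)

Section Expansion.
Context (R : realType) (D : omin_structure R) (n : nat).
Context (f : 'rV[R]_n -> 'rV[R]_n) (df : dfun D f) (cf : continuous f).

Lemma dfunR_dot w : dfunR D (fun x => dot w (f x)).
Proof.
apply: dfunR_sum => i; apply: dfunR_mul; first exact: dfunR_const.
exact: df.
Qed.

Lemma dot_comp_continuous w : continuous (fun x => dot w (f x)).
Proof.
by move=> x; apply: (@continuous_comp _ _ _ f (dot w)); [exact: cf|exact: dot_continuous].
Qed.

(** The mean value inequality holds between [z + s *: v] and [z + t *: v] for [0 < s < t];
    continuity lets [s] tend to 0. *)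
Lemma slope_ge_right_closure (phi : 'rV[R]_n -> R) v c z d : continuous phi ->
  0 < d -> (forall t, 0 < t -> t < d -> slope_ge phi v c (z + t *: v)) ->
  slope_ge phi v c z.
Proof.
move=> cphi d0 H; exists d; split=> // t t0 td.
pose h s := phi (z + s *: v) - c * s.
have hc : continuous h.
  move=> s; apply: (@cvgB _ _ _ (nbhs s)); first exact: line_continuous.
  by apply: cvgMl_tmp; exact: cvg_id.
suff : h 0 <= h t by rewrite /h scale0r addr0; lra.
rewrite leNgt; apply/negP => ht.
have : \forall s \near (0 : R), h t < h s by exact: (cvgr_gt (h 0) (hc 0) _ ht).
move=> /nbhs_ballP[e /= e0 He].
pose s := Num.min t e / 2.
have m0 : 0 < Num.min t e by rewrite lt_min t0.
have s0 : 0 < s by rewrite /s; lra.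
have st : s < t by rewrite (@lt_le_trans _ _ (Num.min t e)) ?ge_min ?lexx// /s; lra.
have se : s < e by rewrite (@lt_le_trans _ _ (Num.min t e)) ?ge_min ?lexx ?orbT// /s; lra.
have : h t < h s by apply: He; rewrite -ball_normE /= sub0r normrN gtr0_norm.
rewrite ltNge => /negP; apply.
have ts0 : 0 <= t - s by lra.
have := @slope_ge_segment _ _ phi v c (z + s *: v) (t - s) cphi ts0.
have -> : z + s *: v + (t - s) *: v = z + t *: v by rewrite -addrA -scalerDl [s + _]addrC subrK.
move=> H1; suff : c * (t - s) <= phi (z + t *: v) - phi (z + s *: v) by rewrite /h; lra.
by apply: H1 => r r0 rt; rewrite -addrA -scalerDl; apply: H; lra.
Qed.

(* If the slope is too small at [x], then for some [s > 0] it is too small on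
   average over [z, z + s v] for all [z] near [x].  Each of these segments then
   contains an interval of points with too small a slope, which may be taken with
   rational end points; the covering property gives an open set of such points. *)
Lemma slope_ge_of_dense (phi : 'rV[R]_n -> R) v c (B : set 'rV[R]_n) :
  dfunR D phi -> continuous phi -> open B ->
  (forall x l t, B x -> B (x + l *: v) -> 0 <= t -> t <= l -> B (x + t *: v)) ->
  (forall U : set 'rV[R]_n, open U -> U !=set0 -> U `<=` B ->
     exists2 u, U u & slope_ge phi v c u) ->
  forall x, B x -> slope_ge phi v c x.
Proof.
move=> dphi cphi oB convB dense x Bx; apply: contrapT => nx.
pose W z := ~ slope_ge phi v c z.
have dW : dset D W.
  by apply/dset_not/dset_slope_ge => //; [exact: dfunR_const|exact: dfun_id].
have [d d0 Hd] := slope_geVlt dphi nx.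
have [d' d'0 Bd'] : exists2 d', 0 < d' & forall s, 0 < s -> s < d' -> B (x + s *: v).
  have [r r0 rB] := open_ball_sub oB Bx.
  have /near_rightP[d' d'0 H] := near0_line x v r0.
  by exists d' => // s s0 sd; apply: rB; apply: H; rewrite ?add0r.
pose s := Num.min d d' / 2.
have m0 : 0 < Num.min d d' by rewrite lt_min d0.
have s0 : 0 < s by rewrite /s; lra.
have sd : s < d by rewrite (@lt_le_trans _ _ (Num.min d d')) ?ge_min ?lexx// /s; lra.
have sd' : s < d' by rewrite (@lt_le_trans _ _ (Num.min d d')) ?ge_min ?lexx ?orbT// /s; lra.
have Hs := Hd _ s0 sd.
pose N : set 'rV[R]_n := [set z | B z /\ B (z + s *: v) /\ phi (z + s *: v) - phi z < c * s].
have csh : continuous (fun z : 'rV[R]_n => z + s *: v).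
  by move=> z; apply: (@cvgD _ _ _ (nbhs z) _ id); [exact: (@cvg_id _ (nbhs z))|exact: cvg_cst].
have oN : open N.
  apply: openI => //; apply: openI.
    by apply: open_comp oB => z _; exact: csh.
  have cg : continuous (fun z => phi (z + s *: v) - phi z).
    move=> z; apply: (@cvgB _ _ _ (nbhs z)); last exact: cphi.
    apply: (@continuous_comp _ _ _ (fun z : 'rV[R]_n => z + s *: v) phi).
      exact: csh.
    exact: cphi.
  apply: (@open_comp _ _ (fun z => phi (z + s *: v) - phi z) [set t | t < c * s]).
    by move=> z _; exact: cg.
  exact: open_lt.
have Nx : N x by split=> //; split=> //; exact: Bd'.
pose X (k : rat * rat) z := (0 < ratr k.1 :> R /\ ratr k.1 < ratr k.2 :> R /\ ratr k.2 < s) /\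
  forall t, ratr k.1 < t -> t < ratr k.2 -> W (z + t *: v).
have dX k : dset D (X k).
  apply: dset_and; first exact: dset_const.
  have dt : dfunR D (fun z : 'rV_(n + 1) => rsubmx z 0 0).
    by apply/dfunR_coord/dfun_rsubmx/dfun_id.
  apply: dset_forall; apply: dset_imp.
    by apply: dset_lt => //; exact: dfunR_const.
  apply: dset_imp; first by apply: dset_lt => //; exact: dfunR_const.
  apply: (dset_comp _ dW); apply: dfun_add; first by apply/dfun_lsubmx/dfun_id.
  by apply: dfun_scale => //; exact: dfun_const.
have [||[p q] [U [oU [u Uu] UN UX]]] := @dset_cover R D n _ X N dX oN.
- by exists x.
- move=> z [Bz [Bzs]]; rewrite ltNge => /negP nle.
  have [t t0 [ts nslope]] : exists2 t, 0 <= t & t < s /\ ~ slope_ge phi v c (z + t *: v).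
    apply: contrapT => /forall2NP H; apply: nle; apply: slope_ge_segment => //.
      exact: ltW.
    by move=> t t0 ts; apply: contrapT => nt; case: (H t) => [/(_ t0)|[]].
  have [t1 [t10 [t1s [e e0 He]]]] : exists t1, 0 <= t1 /\ t1 < s /\
      exists2 e, 0 < e & forall r, t1 < r -> r < t1 + e -> W (z + r *: v).
    exists t; split=> //; split=> //.
    (* Tameness along the line: were the slope large enough just to the right of [t], it would be so
       at [t] too. *)
    have [/near_rightP//|/near_rightP[e e0 He]] := dset_near_right_line z v t dW.
    exfalso; apply: nslope; apply: (slope_ge_right_closure cphi e0) => r r0 re.
    by apply: contrapT; rewrite -addrA -scalerDl; apply: He; lra.
  have tm : t1 < Num.min (t1 + e) s by rewrite lt_min t1s ltrDl e0.
  have [q /[!in_itv]/= /andP[tq qm]] := rat_in_itvoo tm.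
  have [p /[!in_itv]/= /andP[tp pq]] := rat_in_itvoo tq.
  move: qm; rewrite lt_min => /andP[qe qs].
  exists (p, q); split => /=.
    by split; [exact: le_lt_trans tp|split].
  by move=> r pr rq; apply: He; [exact: lt_trans pr|exact: lt_trans qe].
have [[/= p0 [pq qs]] _] := UX _ Uu.
pose r : R := (ratr p + ratr q) / 2.
have rW z : U z -> W (z + r *: v).
  by move=> /UX[_]; apply => /=; rewrite /r; move: pq; set a := ratr p; set b := ratr q; lra.
(* The translate of [U] by [r *: v] consists of points with too small a slope, and it stays in [B]
   because both ends of each segment do. *)
have [|||w Uw] := dense [set w | U (w - r *: v)].
- apply: open_comp oU => z _.
  by apply: (@cvgB _ _ _ (nbhs z) _ id); [exact: (@cvg_id _ (nbhs z))|exact: cvg_cst].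
- by exists (u + r *: v); rewrite /= addrK.
- move=> w /= Uw; have [Bw [Bws _]] := UN _ Uw.
  have := convB _ _ r Bw Bws; rewrite subrK; apply; rewrite /r.
    by move: p0 pq; set a := ratr p; set b := ratr q; lra.
  by move: qs pq; set a := ratr p; set b := ratr q; lra.
by move=> sw; have := rW _ Uw; rewrite subrK; apply.
Qed.

Lemma eball_segment x0 r (x v : 'rV[R]_n) l t : eball x0 r x ->
  eball x0 r (x + l *: v) -> 0 <= t -> t <= l -> eball x0 r (x + t *: v).
Proof.
rewrite /eball /= => bx bxl t0 tl.
have [l_eq0|l0] := eqVneq l 0.
  have -> : t = 0 by apply/eqP; rewrite eq_le t0 andbT -l_eq0.
  by rewrite scale0r addr0.
have lp : 0 < l by rewrite lt_neqAle eq_sym l0 (le_trans t0).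
set a := t / l; have a0 : 0 <= a by rewrite divr_ge0// ltW.
have a1 : a <= 1 by rewrite ler_pdivrMr// mul1r.
have -> : x + t *: v - x0 = (1 - a) *: (x - x0) + a *: (x + l *: v - x0).
  have -> : t *: v = a *: (l *: v) by rewrite scalerA /a divfK.
  by move: (l *: v) => w; apply/rowP => i; rewrite !mxE; ring.
rewrite (le_lt_trans (enormD _ _))// !enormZ !ger0_norm ?subr_ge0//.
have [->|an] := eqVneq a 0; first by rewrite subr0 mul1r mul0r addr0.
have ap : 0 < a by rewrite lt_neqAle eq_sym an.
set A := enorm (x - x0) in bx *; set B := enorm _ in bxl *.
have P1 : 0 < a * (r - B) by rewrite mulr_gt0//; lra.
have P2 : 0 <= (1 - a) * (r - A) by rewrite mulr_ge0//; lra.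
lra.
Qed.

Lemma conv_hull_convex (S : set 'M[R]_n) (A B : 'M[R]_n) l :
  conv_hull S A -> conv_hull S B -> 0 <= l -> l <= 1 ->
  conv_hull S ((1 - l) *: A + l *: B).
Proof.
move=> SA SB l0 l1 C [Cc SC].
(* The convex combination gives the weight [l] to its first argument, hence the order [B], [A]. *)
have := Cc B A (Itv01 l0 l1) (mem_set (SB C (conj Cc SC))) (mem_set (SA C (conj Cc SC))).
by move=> /set_mem; rewrite addrC.
Qed.

(** A mean value inequality along [v] for the scalar function [dot w (f _)], whose derivative is at
    least [m] at the C^1 points; Cauchy-Schwarz then returns to the norm. *)
Lemma expansion x0 r m : 0 < m ->
  (forall A v, conv_hull (dimage f (eball x0 r)) A -> enorm v = 1 ->
     m <= enorm (v *m A)) ->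
  forall x y, eball x0 r x -> eball x0 r y -> m * enorm (y - x) <= enorm (f y - f x).
Proof.
move=> m0 Hm x y bx by_.
have [L0|Ln0] := eqVneq (enorm (y - x)) 0; first by rewrite L0 mulr0 enorm_ge0.
set L := enorm (y - x) in Ln0 *.
have Lp : 0 < L by rewrite lt_neqAle eq_sym Ln0 enorm_ge0.
pose v := L^-1 *: (y - x).
have v1 : enorm v = 1 by rewrite enormZ gtr0_norm ?invr_gt0// mulVf.
have yE : y = x + L *: v by rewrite scalerA divff// scale1r addrC subrK.
pose S := dimage f (eball x0 r).
have dimS u : eball x0 r u -> C1_near f u -> conv_hull S ('J f u).
  by move=> bu Cu C [_]; apply; exists u => //; split => //; apply.
have [w w1 Hw] : exists2 w, enorm w = 1 &
    forall c, [set v *m A | A in conv_hull S] c -> m <= dot w c.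
  apply: convex_separation => //.
  - have [u bu Cu] := C1_dense df cf (@eball_open _ _ x0 r) (ex_intro _ x bx).
    by exists (v *m 'J f u), ('J f u) => //; exact: dimS.
  - move=> _ _ l [A SA <-] [B SB <-] l0 l1.
    exists ((1 - l) *: A + l *: B); first exact: conv_hull_convex.
    by rewrite mulmxDr -!scalemxAr.
  - by move=> _ [A SA <-]; exact: Hm.
pose phi z := dot w (f z).
(* A derivative strictly above [m'] makes the nearby difference quotients at least [m']; the value
   [m] is reached at the end by letting [m'] tend to it. *)
have slope m' : m' < m -> forall z, eball x0 r z -> slope_ge phi v m' z.
  move=> m'm; apply: slope_ge_of_dense.
  - exact: dfunR_dot.
  - exact: dot_comp_continuous.
  - exact: (@eball_open _ _ x0 r).
  - by move=> z l t bz bl t0 tl; exact: eball_segment bz bl t0 tl.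
  - move=> U oU U0 UB; have [u Uu Cu] := C1_dense df cf oU U0.
    exists u => //.
    have [dfu _] : differentiable f u /\ {for u, continuous (jacobian f)}.
      exact: nbhs_singleton Cu.
    have mD : m' < dot w ('D_v f u).
      rewrite (lt_le_trans m'm)// deriveEjacobian//; apply: Hw.
      by exists ('J f u) => //; apply: dimS => //; exact: UB.
    have dv : derivable f u v by exact: diff_derivable.
    have : (fun h => dot w (h^-1 *: (f (h *: v + u) - f u))) h @[h --> 0^'] --> dot w ('D_v f u).
      exact: (@continuous_cvg _ _ _ _ _ _ (dot w) _ (@dot_continuous _ _ w _) dv).
    move=> /(cvgr_gt _)/(_ _ mD); rewrite near_withinE => /nbhs_ballP[e /= e0 He].
    exists e; split=> // s s0 se.
    have := He s; rewrite -ball_normE /= sub0r normrN gtr0_norm// => /(_ se (lt0r_neq0 s0)).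
    rewrite dotZr dotBr addrC mulrC ltr_pdivlMr// => /ltW.
    by rewrite [s *: v + u]addrC [- _ + _]addrC.
have H m' : m' < m -> m' * L <= enorm (f y - f x).
  move=> m'm; have := @slope_ge_segment _ _ phi v m' x L (@dot_comp_continuous w) (ltW Lp).
  rewrite -yE => H.
  have {H} : m' * L <= phi y - phi x.
    apply: H => t t0 tL; apply: slope => //; apply: eball_segment bx _ t0 (ltW tL).
    by rewrite -yE.
  rewrite -dotBr => /le_trans; apply; rewrite (le_trans (dot_le_enorm _ _))//.
  by rewrite w1 mul1r.
rewrite -ler_pdivlMr//; apply/ler_addgt0Pr => e e0.
rewrite -lerBlDr ler_pdivlMr//; apply: H; lra.
Qed.

End Expansion.

(** * Local expansion from [nu] and from the emptiness of [K_infty] *)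

Section Nu.
Context (R : realType) (n : nat).
Context (f : 'rV[R]_n -> 'rV[R]_n).
Implicit Types x : 'rV[R]_n.

Definition sigma_inf x (r : R) : \bar R :=
  ereal_inf (@sigma R n @` conv_hull (dimage f (eball x r))).

Lemma sigma_ge0 (A : 'M[R]_n) : (0 <= sigma A)%E.
Proof. by apply: le_ereal_inf_tmp => _ [v _ <-]; rewrite lee_fin enorm_ge0. Qed.

Lemma conv_hull_sub (S T : set 'M[R]_n) : S `<=` T -> conv_hull S `<=` conv_hull T.
Proof.
move=> ST A SA C [Cc TC]; apply: SA; split => //; exact: subset_trans TC.
Qed.

(** Smaller balls have smaller hulls, so the infimum increases as [r] decreases and its limit is a
    supremum. *)
Lemma nuE x : nu f x = ereal_sup [set sigma_inf x r | r in [set` `]0, +oo[%R]].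
Proof.
apply: cvg_lim => //; apply: nonincreasing_at_right_cvge => //.
move=> r s _ _ rs; apply/ereal_infP => _ [A SA <-].
apply: ge_ereal_inf; exists (sigma A) => //; exists A => //.
apply: conv_hull_sub SA => _ [y [by_ ny] <-]; exists y => //; split => //.
exact: lt_le_trans rs.
Qed.

Lemma nu_ge0 x : (0 <= nu f x)%E.
Proof.
rewrite nuE; apply: (@le_trans _ _ (sigma_inf x 1)).
  by apply: le_ereal_inf_tmp => _ [A _ <-]; exact: sigma_ge0.
by apply: le_ereal_sup_tmp; exists (sigma_inf x 1) => //; exists 1 => //=; rewrite in_itv /= ltr01.
Qed.

Lemma nu_expansion (D : omin_structure R) x m : dfun D f -> continuous f ->
  0 < m -> (m%:E < nu f x)%E ->
  exists2 r, 0 < r & forall y z, eball x r y -> eball x r z ->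
    m * enorm (z - y) <= enorm (f z - f y).
Proof.
move=> df cf m0; rewrite nuE => /ereal_sup_gt[_ [r + <-] mr].
rewrite /= in_itv /= andbT => r0; exists r => // y z by_ bz.
apply: (expansion df cf m0 _ by_ bz) => A v HA v1; rewrite -lee_fin.
rewrite (le_trans (ltW mr))// (@le_trans _ _ (sigma A))//.
  by apply: ge_ereal_inf; exists (sigma A) => //; exists A.
by apply: ge_ereal_inf; exists (enorm (v *m A))%:E => //; exists v.
Qed.

(** If every [e] failed, failures for [e = 1 / (k + 1)] would form a sequence witnessing that [y]
    belongs to [K_infty f]. *)
Lemma K_infty_lower_bound : K_infty f = set0 -> forall y, exists2 e, 0 < e &
  forall x, e^-1 <= enorm x -> enorm (f x - y) < e ->
    (e%:E <= (enorm x)%:E * nu f x)%E.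
Proof.
move=> K0 y; apply: contrapT => /forall2NP H.
have Hk (k : nat) : exists x, [/\ k.+1%:R <= enorm x, enorm (f x - y) < k.+1%:R^-1 &
    ((enorm x)%:E * nu f x < k.+1%:R^-1%:E)%E].
  case: (H k.+1%:R^-1) => [|/existsNP[x /not_implyP[x1 /not_implyP[x2 /negP]]]].
    by rewrite invr_gt0.
  by rewrite -ltNge => x3; exists x; split => //; rewrite invrK in x1.
have /choice[x_ Hx] := Hk.
have h0 : (k.+1%:R^-1 : R) @[k --> \oo] --> (0 : R) by exact: cvg_harmonic.
have : K_infty f y.
  exists x_; split.
  - apply/cvgryPge => A; exists (Num.truncn `|A|) => // k /= Ak.
    have [+ _ _] := Hx k => /(le_trans _); apply.
    rewrite (le_trans (ler_norm _))// ltW// (lt_le_trans (truncnS_gt _))//.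
    by rewrite ler_nat ltnS.
  - apply/cvgrPdist_lt => e e0.
    have /cvgrPdist_lt/(_ _ e0)[N _ HN] := h0; exists N => // k /HN /=.
    rewrite sub0r normrN ger0_norm ?invr_ge0// => ke.
    rewrite (le_lt_trans (norm_le_enorm _))// enormB.
    by have [_ + _] := Hx k; move=> /lt_trans; apply.
  - apply: (@squeeze_cvge _ _ _ _ (cst 0%E) _ (fun k => k.+1%:R^-1%:E)).
    + exists 0%N => // k _; apply/andP; split.
        by rewrite mule_ge0// ?nu_ge0// lee_fin enorm_ge0.
      by have [_ _ /ltW] := Hx k.
    + exact: cvg_cst.
    + by apply: cvg_EFin => //; exists 0%N.
by rewrite K0.
Qed.

Lemma K_infty_expansion (D : omin_structure R) : dfun D f -> continuous f ->
  K_infty f = set0 -> forall y, exists2 e, 0 < e &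
  forall x, e^-1 <= enorm x -> enorm (f x - y) < e ->
  exists2 r, 0 < r & forall z, eball x r z ->
    e * enorm (z - x) <= enorm x * enorm (f z - f x).
Proof.
move=> df cf K0 y; have [e e0 He] := K_infty_lower_bound K0 y.
(* Halving makes [e / 2 / enorm x < nu f x] strict, as [nu_expansion] requires. *)
exists (e / 2); first by lra.
move=> x xe fxy.
have xe' : e^-1 <= enorm x.
  by apply: le_trans xe; rewrite lef_pV2 ?posrE; lra.
have xp : 0 < enorm x by apply: lt_le_trans xe'; rewrite invr_gt0.
have := He x xe' ltac:(lra) => enu.
have m0 : 0 < e / 2 / enorm x by rewrite !divr_gt0.
have mnu : ((e / 2 / enorm x)%:E < nu f x)%E.
  rewrite ltNge; apply/negP => nule.
  have : ((enorm x)%:E * nu f x <= (e / 2)%:E)%E.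
    rewrite -[e / 2](@divfK _ (enorm x)) ?gt_eqF// mulrC EFinM.
    by apply: lee_wpmul2l => //; rewrite lee_fin ltW.
  by move=> /(le_trans enu); rewrite lee_fin; lra.
have [r r0 Hr] := nu_expansion df cf m0 mnu.
exists r => // z bz.
have bx : eball x r x by rewrite /eball /= subrr enorm0.
have := Hr x z bx bz.
by rewrite mulrAC ler_pdivrMr// [_ * enorm x]mulrC.
Qed.

End Nu.

(** * Lifting segments *)

Section Lifting.
Context (R : realType) (n : nat).
Context (f : 'rV[R]_n -> 'rV[R]_n).
Implicit Types (a w x y z : 'rV[R]_n) (N : set 'rV[R]_n).


Lemma local_homeo_continuous : local_homeo f -> continuous f.
Proof.
move=> lf x; have [U [oU Ux _ [cf _]]] := lf x.
by move: cf; rewrite continuous_open_subspace// => /(_ x (mem_set Ux)).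
Qed.

Definition section_on N (s : 'rV[R]_n -> 'rV[R]_n) :=
  forall z, N z -> {for z, continuous s} /\ f (s z) = z.

Lemma local_section : local_homeo f -> forall x, exists e s U,
  [/\ 0 < e, section_on (eball (f x) e) s, open U, U x &
    forall x', U x' -> eball (f x) e (f x') -> s (f x') = x'].
Proof.
move=> lf x; have [U [oU Ux oV [_ [g [cg fU gV fK gK]]]]] := lf x.
have [r r0 rV] : exists2 r, 0 < r & ball (f x) r `<=` f @` U.
  by apply: open_ball_sub => //; exists x.
exists r, g, U; split => //; last by move=> x' Ux' _; apply: fK; exact: mem_set.
move=> z bz; have Vz : (f @` U) z.
  apply: rV; rewrite -ball_normE /=; apply: le_lt_trans (norm_le_enorm _) _.
  by rewrite enormB.
split; last by apply: gK; exact: mem_set.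
by move: cg; rewrite continuous_open_subspace// => /(_ z (mem_set Vz)).
Qed.

Lemma near_enorm (T : Type) (F : set_system T) {FF : Filter F} (g : T -> 'rV[R]_n) l r :
  g t @[t --> F] --> l -> 0 < r -> \forall t \near F, enorm (g t - l) < r.
Proof.
move=> gl r0; have bl : nbhs l (eball l r).
  by apply: open_nbhs_nbhs; split; [exact: eball_open|rewrite /eball /= subrr enorm0].
exact: (gl _ bl).
Qed.

(** Agreement extends to the right because a local section recovers both paths from their common
    image, and to left limits by continuity. *)
Lemma unique_lift (p q : R -> 'rV[R]_n) : local_homeo f ->
  (forall t, 0 <= t -> t <= 1 -> {for t, continuous p}) ->
  (forall t, 0 <= t -> t <= 1 -> {for t, continuous q}) ->
  (forall t, 0 <= t -> t <= 1 -> f (p t) = f (q t)) -> p 0 = q 0 -> p 1 = q 1.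
Proof.
move=> lf cp cq fpq pq0; have cf := local_homeo_continuous lf.
apply: (@real_induction _ 0 1 (fun t => p t = q t)) => // [t t0 t1 pqt|t t0 t1 H].
  have [e [s [U [e0 se oU Ux sK]]]] := local_section lf (p t).
  have nearF (g : R -> 'rV[R]_n) : {for t, continuous g} -> g t = p t ->
      \forall r \near t, U (g r) /\ eball (f (p t)) e (f (g r)).
    move=> cg gp; have cfg : f (g r) @[r --> t] --> f (g t).
      by apply: continuous_cvg cg; exact: cf.
    have H1 : \forall r \near t, enorm (f (g r) - f (p t)) < e.
      by rewrite -gp; exact: near_enorm cfg e0.
    have H2 : \forall r \near t, U (g r).
      by apply: cg; apply: open_nbhs_nbhs; rewrite gp.
    by apply: filterS2 H1 H2 => r.
  have := nearF p (cp _ t0 (ltW t1)) erefl.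
  have := nearF q (cq _ t0 (ltW t1)) (esym pqt).
  move=> /nbhs_ballP[d1 /= d10 H1] /nbhs_ballP[d2 /= d20 H2].
  exists (Num.min (Num.min d1 d2) (1 - t)).
    by rewrite !lt_min d10 d20 subr_gt0.
  move=> r tr; rewrite -ltrBlDl !lt_min => /andP[/andP[r1 r2] r3].
  have abs (d : R) : r - t < d -> ball t d r.
    by move=> rd; rewrite -ball_normE /= distrC gtr0_norm// subr_gt0.
  have [Up bp] := H2 r (abs _ r2); have [Uq bq] := H1 r (abs _ r1).
  by rewrite -(sK _ Up bp) -(sK _ Uq bq) fpq//; lra.
apply: contrapT => /eqP neq.
pose e := enorm (p t - q t).
have e0 : 0 < e.
  rewrite lt_neqAle enorm_ge0 andbT eq_sym; apply: contra neq => /eqP/enorm_eq0/eqP.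
  by rewrite subr_eq0.
have e2 : 0 < e / 2 by lra.
have H1 : \forall r \near t, enorm (p r - p t) < e / 2.
  exact: near_enorm (cp _ (ltW t0) t1) e2.
have H2 : \forall r \near t, enorm (q r - q t) < e / 2.
  exact: near_enorm (cq _ (ltW t0) t1) e2.
have : \forall r \near t, p r != q r.
  apply: filterS2 H1 H2 => r h1 h2; apply/eqP => pqr.
  have := enormD (p t - q r) (q r - q t); rewrite addrA subrK -/e -{1}pqr enormB.
  by lra.
move=> /nbhs_ballP[d /= d0 Hd].
pose r := Num.max 0 (t - d / 2).
have rt : r < t by rewrite gt_max t0; lra.
have r0 : 0 <= r by rewrite le_max lexx.
have rd : t - d / 2 <= r by rewrite le_max lexx orbT.
have := Hd r; rewrite H// eqxx => H3; suff : false by [].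
by apply: H3; rewrite -ball_normE /= gtr0_norm; lra.
Qed.

(** This is convexity, written with a base point and a direction. *)
Definition segment_closed N := forall x v t, N x -> N (x + v) -> 0 <= t -> t <= 1 -> N (x + t *: v).

Lemma line_cvg x v (t : R) : (x + s *: v) @[s --> t] --> x + t *: v.
Proof. by apply: cvgD; [exact: cvg_cst|apply: cvgZr_tmp; exact: cvg_id]. Qed.

(** Both sections lift the segment from [z0] to [z] with the same origin, so [unique_lift]
    applies. *)
Lemma section_unique N s s' z0 z : local_homeo f -> segment_closed N ->
  section_on N s -> section_on N s' -> N z0 -> s z0 = s' z0 -> N z -> s z = s' z.
Proof.
move=> lf cN ss ss' N0 e0 Nz.
have Nt t : 0 <= t -> t <= 1 -> N (z0 + t *: (z - z0)).
  by apply: cN => //; rewrite [z0 + _]addrC subrK.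
have := @unique_lift (fun t => s (z0 + t *: (z - z0))) (fun t => s' (z0 + t *: (z - z0))) lf.
have zE : z0 + (z - z0) = z by rewrite addrC subrK.
rewrite /= scale0r addr0 scale1r zE; apply => //.
- move=> t t0 t1; apply: (@continuous_cvg _ _ _ (nbhs t) _ _ s _ (ss _ (Nt t t0 t1)).1).
  exact: line_cvg.
- move=> t t0 t1; apply: (@continuous_cvg _ _ _ (nbhs t) _ _ s' _ (ss' _ (Nt t t0 t1)).1).
  exact: line_cvg.
- by move=> t t0 t1; rewrite (ss _ (Nt t t0 t1)).2 (ss' _ (Nt t t0 t1)).2.
Qed.

(** The open Euclidean [d]-neighbourhood of the segment from [a] to [a + T *: w]. *)
Definition tube a w (T d : R) : set 'rV[R]_n :=
  [set z | exists2 s, 0 <= s <= T & enorm (z - (a + s *: w)) < d].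

Lemma tube_open a w T d : open (tube a w T d).
Proof.
have -> : tube a w T d = \bigcup_(s in [set s : R | 0 <= s <= T]) eball (a + s *: w) d.
  by apply/seteqP; split => z [s s1 s2]; exists s.
by apply: bigcup_open => s _; exact: eball_open.
Qed.

Lemma tube_line a w T d s : 0 < d -> 0 <= s -> s <= T -> tube a w T d (a + s *: w).
Proof. by move=> d0 s0 sT; exists s; rewrite ?s0 ?sT// subrr enorm0. Qed.

Lemma tube_base a w T d : 0 < d -> 0 <= T -> tube a w T d a.
Proof. by move=> d0 T0; have := @tube_line a w T d 0 d0 (lexx _) T0; rewrite scale0r addr0. Qed.

Lemma tube_segment_closed a w T d : segment_closed (tube a w T d).
Proof.
move=> x v t [s1 /andP[s10 s1T] b1] [s2 /andP[s20 s2T] b2] t0 t1.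
exists ((1 - t) * s1 + t * s2).
  by apply/andP; split; nra.
have -> : x + t *: v - (a + ((1 - t) * s1 + t * s2) *: w) =
    (1 - t) *: (x - (a + s1 *: w)) + t *: (x + v - (a + s2 *: w)).
  by apply/rowP => i; rewrite !mxE; ring.
rewrite (le_lt_trans (enormD _ _))// !enormZ !ger0_norm ?subr_ge0//.
have [->|tn] := eqVneq t 0; first by rewrite subr0 mul1r mul0r addr0.
have tp : 0 < t by rewrite lt_neqAle eq_sym tn.
set A := enorm _ in b1 *; set B := enorm _ in b2 *.
have P1 : 0 < t * (d - B) by rewrite mulr_gt0//; lra.
have P2 : 0 <= (1 - t) * (d - A) by rewrite mulr_ge0//; lra.
lra.
Qed.

Lemma eball_segment_closed x r : segment_closed (eball x r).
Proof.
move=> z v t bz bzv t0 t1; apply: (@eball_segment _ _ _ _ _ _ 1) => //.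
by rewrite scale1r.
Qed.

Lemma segment_closedI N N' : segment_closed N -> segment_closed N' ->
  segment_closed (N `&` N').
Proof. by move=> cN cN' x v t [? ?] [? ?] t0 t1; split; [exact: cN|exact: cN']. Qed.

Lemma section_onS N N' s : N `<=` N' -> section_on N' s -> section_on N s.
Proof. by move=> NN ss z /NN; exact: ss. Qed.

Lemma section_glue N N' s s' : open N -> open N' ->
  section_on N s -> section_on N' s' ->
  (forall z, N z -> N' z -> s z = s' z) ->
  exists t, section_on (N `|` N') t /\ (forall z, N z -> t z = s z).
Proof.
move=> oN oN' ss ss' E.
pose t z := if pselect (N z) then s z else s' z.
have tN z : N z -> t z = s z by rewrite /t; case: pselect.
have tN' z : N' z -> t z = s' z.
  by rewrite /t; case: pselect => // Nz N'z; exact: E.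
have cont M u z : open M -> M z -> (forall z, M z -> t z = u z) ->
    {for z, continuous u} -> {for z, continuous t}.
  move=> oM Mz tu cu; rewrite /prop_for /continuous_at (tu _ Mz).
  have tuz : \forall y \near z, u y = t y.
    by have := open_nbhs_nbhs (conj oM Mz); apply: filterS => y /tu.
  exact: (cvg_trans (@near_eq_cvg _ _ (nbhs z) _ _ _ tuz) cu).
exists t; split=> // z [Nz|Nz].
  have [cs fs] := ss _ Nz; split; last by rewrite tN.
  exact: cont oN Nz tN cs.
have [cs fs] := ss' _ Nz; split; last by rewrite tN'.
exact: cont oN' Nz tN' cs.
Qed.

(* A section of [f] over a convex neighbourhood of the segment, rather than a mere
   lift of the segment, so that the lifts depend continuously on the end point. *)
Definition lift_to a w x0 T :=
  exists d s, [/\ 0 < d, section_on (tube a w T d) s & s a = x0].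

Lemma lift_to0 w x0 : local_homeo f -> lift_to (f x0) w x0 0.
Proof.
move=> lf; have [e [s [U [e0 se oU Ux sK]]]] := local_section lf x0.
exists e, s; split => //.
  move=> z [r /andP[ra rb] zr]; apply: se; rewrite /eball /=.
  have r0 : r = 0 by apply/eqP; rewrite eq_le ra rb.
  by rewrite r0 scale0r addr0 in zr.
by apply: sK => //; rewrite /eball /= subrr enorm0.
Qed.

(** The tube of half the radius around a slightly longer segment lies in the given tube, so the same
    section serves. The [+ 1] in the bound allows [w = 0]. *)
Lemma lift_to_right a w x0 t : 0 <= t -> lift_to a w x0 t ->
  exists2 e, 0 < e & forall t', t < t' -> t' < t + e -> lift_to a w x0 t'.
Proof.
move=> t0 [d [s [d0 ss sa]]]; have w0 := enorm_ge0 w.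
have w1 : 0 < enorm w + 1 by lra.
exists (d / 2 / (enorm w + 1)); first by rewrite !divr_gt0.
move=> t' tt'; rewrite -ltrBlDl ltr_pdivlMr// => t'd.
exists (d / 2), s; split => //; first by lra.
apply: section_onS ss => z [r /andP[r0 rt'] br].
have [rt|tr] := leP r t; first by exists r; [rewrite r0|lra].
exists t; first by rewrite t0 lexx.
have -> : z - (a + t *: w) = (z - (a + r *: w)) + (r - t) *: w.
  by apply/rowP => i; rewrite !mxE; ring.
rewrite (le_lt_trans (enormD _ _))// enormZ gtr0_norm ?subr_gt0//.
by have : (r - t) * enorm w <= (t' - t) * (enorm w + 1); nra.
Qed.

End Lifting.

(** * Extension of lifts and the global inverse *)

Section GlobalInverse.
Context (R : realType) (n : nat).
Context (f : 'rV[R]_n -> 'rV[R]_n) (lf : local_homeo f).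
Implicit Types (a w x y z : 'rV[R]_n).

(** The conclusion of [K_infty_expansion], isolated so that the lifting argument is purely
    topological and metric. *)
Definition expands_at_infinity := forall y, exists2 e, 0 < e &
  forall x, e^-1 <= enorm x -> enorm (f x - y) < e ->
  exists2 r, 0 < r & forall z, eball x r z ->
    e * enorm (z - x) <= enorm x * enorm (f z - f x).

(* Gronwall: where [p] is large its speed is at most [K * enorm p]. *)
Lemma lift_bounded a w T (p : R -> 'rV[R]_n) : expands_at_infinity -> 0 < T ->
  (forall t, 0 < t -> t < T -> {for t, continuous p}) ->
  (forall t, 0 < t -> t < T -> f (p t) = a + t *: w) ->
  exists t0 M, [/\ 0 < t0, t0 < T & forall t, t0 <= t -> t < T -> enorm (p t) <= M].
Proof.
move=> fK T0 cp fp; have [e e0 He] := fK (a + T *: w).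
have w0 := enorm_ge0 w.
pose K := enorm w / e; have K0 : 0 <= K by rewrite divr_ge0// ltW.
(* On the last stretch of length [d] the image stays within [e] of the end point, and [T - d] is
   still positive. *)
have d0 : 0 < Num.min (T / 2) (e / (enorm w + 1)) by rewrite lt_min !divr_gt0//; lra.
set d := Num.min _ _ in d0.
have dT : d <= T / 2 by rewrite ge_min lexx.
have dw : d * (enorm w + 1) <= e by rewrite -ler_pdivlMr ?ge_min ?lexx ?orbT//; lra.
pose t0 := T - d; have t0p : 0 < t0 by rewrite /t0; lra.
have t0T : t0 < T by rewrite /t0; lra.
pose M1 := Num.max e^-1 (enorm (p t0)).
have M1e : e^-1 <= M1 by rewrite le_max lexx.
have M10 : 0 < M1 by apply: lt_le_trans M1e; rewrite invr_gt0.
(* The solution of [B' = K * B] with [B t0 = M1], used as a barrier. *)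
pose B t := M1 * expR (K * (t - t0)).
have Bmono s t : s <= t -> B s <= B t.
  by move=> st; rewrite ler_wpM2l ?(ltW M10)// ler_expR ler_wpM2l// lerB.
have B0 : B t0 = M1 by rewrite /B subrr mulr0 expR0 mulr1.
exists t0, (B T); split => // t t0t tT.
have fclose s : t0 <= s -> s < T -> enorm (f (p s) - (a + T *: w)) < e.
  move=> ts sT; rewrite fp//; last by lra.
  have -> : a + s *: w - (a + T *: w) = (s - T) *: w by apply/rowP => i; rewrite !mxE; ring.
  rewrite enormZ ltr0_norm ?subr_lt0//; rewrite /t0 in ts.
  have : (T - s) * enorm w <= d * enorm w by rewrite ler_wpM2r//; lra.
  by lra.
suff : enorm (p t) <= B t by move=> /le_trans; apply; apply: Bmono; exact: ltW.
apply: (@real_induction _ t0 t (fun s => enorm (p s) <= B s)) => //.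
- by rewrite B0 le_max lexx orbT.
- move=> s t0s st ps; have sT := lt_trans st tT.
  have s0 : 0 < s by exact: lt_le_trans t0s.
  have cps := cp s s0 sT.
  have [big|small] := leP e^-1 (enorm (p s)).
    have [r r0 Hr] := He _ big (fclose _ t0s sT).
    have : \forall u \near s, enorm (p u - p s) < r by exact: near_enorm cps r0.
    move=> /nbhs_ballP[d' /= d'0 Hd'].
    exists (Num.min d' (t - s)); first by rewrite lt_min d'0 subr_gt0.
    move=> u su; rewrite -ltrBlDl lt_min => /andP[ud' ut].
    have bu : ball s d' u by rewrite -ball_normE /= distrC gtr0_norm// subr_gt0.
    have := Hr _ (Hd' _ bu); rewrite !fp//; [|lra|lra].
    have -> : a + u *: w - (a + s *: w) = (u - s) *: w by apply/rowP => i; rewrite !mxE; ring.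
    rewrite enormZ gtr0_norm ?subr_gt0// mulrC -ler_pdivlMr// => H.
    have := enormD (p u - p s) (p s); rewrite subrK => /le_trans; apply.
    have {}H : enorm (p u - p s) <= enorm (p s) * (K * (u - s)).
      by apply: le_trans H _; rewrite /K -!mulrA [(u - s) * _]mulrC -!mulrA [_^-1 * _]mulrC.
    (* A linear step stays below the exponential, since [1 + x <= expR x]. *)
    have : enorm (p s) * (1 + K * (u - s)) <= B s * expR (K * (u - s)).
      apply: ler_pM => //; [exact: enorm_ge0| |exact: expR_ge1Dx].
      by rewrite addr_ge0// mulr_ge0//; lra.
    rewrite /B -mulrA -expRD.
    have -> : K * (s - t0) + K * (u - s) = K * (u - t0) by ring.
    by lra.
  have : \forall u \near s, enorm (p u) < e^-1.
    have ce : enorm (p u) @[u --> s] --> enorm (p s).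
      by apply: (@continuous_cvg _ _ _ (nbhs s) _ p (@enorm R n)) cps; exact: enorm_continuous.
    exact: (cvgr_lt (enorm (p s)) ce _ small).
  move=> /nbhs_ballP[d' /= d'0 Hd']; exists d' => // u su ud'.
  have bu : ball s d' u by rewrite -ball_normE /= distrC gtr0_norm; lra.
  rewrite (le_trans (ltW (Hd' _ bu)))// (le_trans M1e)// -B0; apply: Bmono; lra.
- move=> s t0s st H; rewrite leNgt; apply/negP => Bs.
  have s0 : 0 < s by exact: lt_trans t0s.
  have : \forall u \near s, B s < enorm (p u).
    have ce : enorm (p u) @[u --> s] --> enorm (p s).
      apply: (@continuous_cvg _ _ _ (nbhs s) _ p (@enorm R n)) (cp s s0 (le_lt_trans st tT)).
      exact: enorm_continuous.
    exact: (cvgr_gt (enorm (p s)) ce _ Bs).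
  move=> /nbhs_ballP[d' /= d'0 Hd'].
  pose u := Num.max t0 (s - d' / 2).
  have us : u < s by rewrite gt_max t0s; lra.
  have ut0 : t0 <= u by rewrite le_max lexx.
  have ud : s - d' / 2 <= u by rewrite le_max lexx orbT.
  have bu : ball s d' u by rewrite -ball_normE /= gtr0_norm; lra.
  have := lt_le_trans (Hd' _ bu) (H _ ut0 us).
  by rewrite ltNge Bmono// ltW.
Qed.

(** The lift [p] over [[0, T[] is bounded near [T], so it has a cluster point [x] there, with [f x]
    equal to the end point. A local section at [x] is glued to the section over the tube at some [t]
    close to [T]. *)
Lemma lift_to_left w x0 T : expands_at_infinity -> 0 < T ->
  (forall t, 0 <= t -> t < T -> lift_to f (f x0) w x0 t) -> lift_to f (f x0) w x0 T.
Proof.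
move=> fK T0 H; set a := f x0 in H *; have cf := local_homeo_continuous lf.
(* The choice is total in [t]; outside [[0, T[] the pair is a dummy. *)
have /choice[ds Hds] : forall t, exists ds : R * ('rV[R]_n -> 'rV[R]_n), 0 <= t -> t < T ->
    [/\ 0 < ds.1, section_on f (tube a w t ds.1) ds.2 & ds.2 a = x0].
  move=> t; have [[t0 tT]|nt] := pselect (0 <= t /\ t < T).
    by have [d [s ?]] := H t t0 tT; exists (d, s).
  by exists (0, id) => t0 tT; exfalso; apply: nt.
pose s t := (ds t).2; pose d t := (ds t).1.
have dp t : 0 <= t -> t < T -> 0 < d t by move=> t0 tT; have [] := Hds t t0 tT.
have ss t : 0 <= t -> t < T -> section_on f (tube a w t (d t)) (s t).
  by move=> t0 tT; have [] := Hds t t0 tT.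
have sa t : 0 <= t -> t < T -> s t a = x0 by move=> t0 tT; have [] := Hds t t0 tT.
pose p t := s t (a + t *: w).
have fp t : 0 < t -> t < T -> f (p t) = a + t *: w.
  move=> t0 tT; have := ss t (ltW t0) tT (a + t *: w).
  by case=> //; apply: tube_line => //; [exact: dp (ltW t0) tT|exact: ltW].
have sE t t' : 0 <= t -> t <= t' -> t' < T -> s t' (a + t *: w) = p t.
  move=> t0 tt' t'T; have tT := le_lt_trans tt' t'T; have t'0 := le_trans t0 tt'.
  apply: (@section_unique _ _ _ (tube a w t (d t) `&` tube a w t' (d t')) _ _ a) => //.
  - by apply: segment_closedI; exact: tube_segment_closed.
  - by apply: section_onS (ss t' t'0 t'T); exact: subIsetr.
  - by apply: section_onS (ss t t0 tT); exact: subIsetl.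
  - by split; apply: tube_base => //; exact: dp.
  - by rewrite !sa.
  - by split; apply: tube_line => //; exact: dp.
have cp t : 0 < t -> t < T -> {for t, continuous p}.
  (* Around [t] the path [p] is read off the single section chosen at the midpoint [t'] of [t] and
     [T]. *)
  move=> t0 tT; pose t' := (t + T) / 2.
  have tt' : t < t' by rewrite /t'; lra.
  have t'T : t' < T by rewrite /t'; lra.
  have t'0 : 0 <= t' by rewrite /t'; lra.
  have cs : (fun r : R => s t' (a + r *: w)) r @[r --> t] --> s t' (a + t *: w).
    apply: (@continuous_cvg _ _ _ (nbhs t) _ _ (s t')); last exact: line_cvg.
    by have [] := ss t' t'0 t'T (a + t *: w) (tube_line _ _ (dp _ t'0 t'T) (ltW t0) (ltW tt')).
  rewrite /prop_for /continuous_at -(sE t t' (ltW t0) (ltW tt') t'T).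
  pose m := Num.min t (t' - t).
  have m0 : 0 < m by rewrite lt_min t0 subr_gt0.
  have sp : \forall r \near t, s t' (a + r *: w) = p r.
    apply/nbhs_ballP; exists m => // r; rewrite -ball_normE /= lt_min !ltr_norml.
    by move=> /andP[/andP[r1 r2] /andP[r3 r4]]; apply: sE => //; lra.
  exact: (cvg_trans (@near_eq_cvg _ _ (nbhs t) _ _ _ sp) cs).
have [t0 [M [t00 t0T pM]]] := lift_bounded fK T0 cp fp.
pose A : set 'rV[R]_n := [set x | enorm x <= M].
have cA : compact A.
  apply: bounded_closed_compact.
    exists M; split; first exact: num_real.
    by move=> M' MM' x /= xM; rewrite (le_trans (norm_le_enorm _))// (le_trans xM)// ltW.
  apply: (preimage_closed (f := @enorm R n) (D := [set t | t <= M])); last exact: closed_le.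
  by move=> x _; exact: enorm_continuous.
have nearT (P : R -> Prop) : (exists2 e, 0 < e & forall t, T - e < t -> t < T -> P t) ->
    \forall t \near T^'-, P t.
  move=> [e e0 HP]; near=> t; apply: HP.
    by near: t; apply: nbhs_left_gt; lra.
  by near: t; exact: nbhs_left_lt.
have [x [_ clx]] : A `&` cluster (p t @[t --> T^'-]) !=set0.
  apply: cA; apply: nearT; exists (T - t0); first by lra.
  by move=> t t1 tT; apply: pM => //; lra.
(* Along [p] the values of [f] tend to the end point, while [x] is a cluster point and [f] is
   continuous. *)
have fx : f x = a + T *: w.
  apply: contrapT => neq.
  pose e := enorm (f x - (a + T *: w)).
  have e0 : 0 < e.
    rewrite lt_neqAle enorm_ge0 andbT eq_sym; apply/eqP => /enorm_eq0 /eqP.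
    by rewrite subr_eq0 => /eqP.
  have e2 : 0 < e / 2 by lra.
  have H1 : \forall z \near x, enorm (f z - f x) < e / 2 by exact: near_enorm (cf x) e2.
  have w1 : 0 < enorm w + 1 by have := enorm_ge0 w; lra.
  have H2 : (p t @[t --> T^'-]) [set z | enorm (f z - (a + T *: w)) < e / 2].
    apply: nearT; exists (Num.min T (e / 2 / (enorm w + 1))).
      by rewrite lt_min T0 !divr_gt0.
    move=> t; rewrite ltrBlDr -ltrBlDl lt_min => /andP[t1 t2] tT /=.
    rewrite fp//; last by lra.
    have -> : a + t *: w - (a + T *: w) = (t - T) *: w by apply/rowP => i; rewrite !mxE; ring.
    rewrite enormZ ltr0_norm ?subr_lt0//.
    move: t2; rewrite ltr_pdivlMr// => t2; have : 0 < T - t by lra.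
    by lra.
  have [z [/= z1 z2]] := clx _ _ H2 H1.
  have := enormD (f x - f z) (f z - (a + T *: w)); rewrite addrA subrK -/e enormB.
  by lra.
have [eta [sg [U [eta0 ssg oU Ux sgK]]]] := local_section lf x.
rewrite fx in ssg sgK.
have w1 : 0 < enorm w + 1 by have := enorm_ge0 w; lra.
have H2 : (p t @[t --> T^'-]) [set z | exists t,
    [/\ 0 < t, t < T, (T - t) * (enorm w + 1) < eta / 2 & z = p t]].
  apply: nearT; exists (Num.min T (eta / 2 / (enorm w + 1))).
    by rewrite lt_min T0 !divr_gt0.
  move=> t; rewrite ltrBlDr -ltrBlDl lt_min => /andP[t1 t2] tT /=.
  by exists t; split=> //; [lra|rewrite -ltr_pdivlMr].
(* A time close to [T] at which [p t] lies in [U]: there the local section and the tube section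
   agree. *)
have [_ [[t [tp tT tw ->]] Up]] := clx _ _ H2 (open_nbhs_nbhs (conj oU Ux)).
have T_t : 0 < T - t by lra.
have tw' : (T - t) * enorm w < eta / 2 by lra.
have bt : eball (a + T *: w) eta (a + t *: w).
  rewrite /eball /=.
  have -> : a + t *: w - (a + T *: w) = (t - T) *: w by apply/rowP => i; rewrite !mxE; ring.
  by rewrite enormZ ltr0_norm ?subr_lt0//; lra.
have sgp : sg (a + t *: w) = p t by rewrite -(fp t tp tT); apply: sgK => //; rewrite fp.
have Nt : tube a w t (d t) (a + t *: w).
  by apply: tube_line => //; [exact: dp (ltW tp) tT|exact: ltW].
have [u [su uE]] := section_glue (@tube_open _ _ a w t (d t)) (@eball_open _ _ (a + T *: w) eta)
  (ss t (ltW tp) tT) ssg (fun z Nz bz => @section_unique _ _ f _ _ _ (a + t *: w) z lf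
   (segment_closedI (@tube_segment_closed _ _ a w t (d t)) (@eball_segment_closed _ _ _ eta))
   (section_onS (@subIsetl _ _ _) (ss t (ltW tp) tT)) (section_onS (@subIsetr _ _ _) ssg)
   (conj Nt bt) (esym sgp) (conj Nz bz)).
(* Points attached to a parameter [r <= t] lie in the old tube; the others are within
   [eta / 2 + eta / 2] of the end point. *)
exists (Num.min (d t) (eta / 2)), u; split.
- by rewrite lt_min dp ?(ltW tp)//=; lra.
- apply: section_onS su => z [r /andP[r0 rT]]; rewrite lt_min => /andP[b1 b2].
  have [rt|tr] := leP r t; first by left; exists r; rewrite ?r0 ?rt.
  right; rewrite /eball /=.
  have -> : z - (a + T *: w) = (z - (a + r *: w)) + (r - T) *: w.
    by apply/rowP => i; rewrite !mxE; ring.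
  rewrite (le_lt_trans (enormD _ _))// enormZ ler0_norm ?subr_le0//.
  have : (T - r) * enorm w <= (T - t) * enorm w.
    by rewrite ler_wpM2r ?enorm_ge0//; lra.
  by lra.
- rewrite uE; first by exact: sa (ltW tp) tT.
  by apply: tube_base; [exact: dp (ltW tp) tT|exact: ltW].
Unshelve. all: by end_near. Qed.

(** Real induction lifts every segment issued from [f 0], and the end points of the lifts define the
    inverse [g]. *)
Lemma global_homeo : expands_at_infinity -> homeo_on setT setT f.
Proof.
move=> fK; have cf := local_homeo_continuous lf; pose a := f 0.
have lift y : lift_to f a (y - a) 0 1.
  apply: (@real_induction _ 0 1 (fun t => lift_to f a (y - a) 0 t)) => //.
  - exact: lift_to0.
  - by move=> t t0 _; exact: lift_to_right.
  - by move=> t t0 _; exact: lift_to_left.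
have /choice[ds Hds] : forall y, exists ds : R * ('rV[R]_n -> 'rV[R]_n),
    [/\ 0 < ds.1, section_on f (tube a (y - a) 1 ds.1) ds.2 & ds.2 a = 0].
  by move=> y; have [d [s ?]] := lift y; exists (d, s).
pose N y := tube a (y - a) 1 (ds y).1.
have Ny y : N y y.
  have [d0 _ _] := Hds y; have := @tube_line _ _ a (y - a) 1 _ 1 d0 ler01 (lexx _).
  by rewrite scale1r [a + _]addrC subrK.
pose g y := (ds y).2 y.
have fg y : f (g y) = y by have [_ ss _] := Hds y; have [] := ss y (Ny y).
(* On the whole tube of [y] the map [g] is the one section chosen for [y], by uniqueness on the
   intersection of two tubes through [a]; continuity of [g] follows. *)
have gE y z : N y z -> g z = (ds y).2 z.
  move=> Nyz; have [d0 ss sa] := Hds y; have [d0' ss' sa'] := Hds z.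
  apply: (@section_unique _ _ f (N z `&` N y) (ds z).2 (ds y).2 a) => //.
  - by apply: segment_closedI; exact: tube_segment_closed.
  - by apply: section_onS ss'; exact: subIsetl.
  - by apply: section_onS ss; exact: subIsetr.
  - by split; exact: tube_base.
  - by rewrite sa sa'.
have cg : continuous g.
  move=> y; have [d0 ss sa] := Hds y; have [cs _] := ss y (Ny y).
  rewrite /continuous_at [g y](gE y y (Ny y)).
  have gs : \forall z \near y, (ds y).2 z = g z.
    have := open_nbhs_nbhs (conj (@tube_open _ _ a (y - a) 1 (ds y).1) (Ny y)).
    by apply: filterS => z /gE ->.
  exact: (cvg_trans (@near_eq_cvg _ _ (nbhs y) _ _ _ gs) cs).
have ga : g a = 0 by have [_ _] := Hds a.
(* The paths [g (f (t *: x))] and [t *: x] start at 0 and have the same image under [f], so they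
   agree at [t = 1]. *)
have gf x : g (f x) = x.
  have cline (t : R) : {for t, continuous (fun t : R => t *: x)}.
    by apply: cvgZr_tmp; exact: cvg_id.
  have := @unique_lift _ _ f (fun t => g (f (t *: x))) (fun t => t *: x) lf.
  rewrite /= scale1r scale0r; apply => //.
  move=> t _ _; apply: (@continuous_cvg _ _ _ (nbhs t) _ _ g _ (cg _)).
  by apply: (@continuous_cvg _ _ _ (nbhs t) _ _ f _ (cf _)); exact: cline.
split; first exact: continuous_subspaceT.
by exists g; split => //; exact: continuous_subspaceT.
Qed.

End GlobalInverse.

Theorem theorem6p2 (R : realType) (D : omin_structure R) (n : nat)
    (f : 'rV[R]_n -> 'rV[R]_n)
    (f_def : definable_map D f)
    (f_loc : local_homeo f)
    (f_K : K_infty f = set0) :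
  homeo_on setT setT f.
Proof.
apply: global_homeo => //.
apply: (K_infty_expansion (definable_dfun f_def)) => //.
exact: local_homeo_continuous.
Qed.
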